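(* Let $n \geq 7$ be an integer, let $S = \{\pm a, \pm b, \pm c\} \subset \mathbb{Z}_n$ be such that $|S| = 6$ and $\langle S \rangle = \mathbb{Z}_n$, and let $\Gamma = \mathrm{Circ}(n; S)$. Then both of the following hold. (A) If $n$ is not divisible by $3$, then $\Gamma$ is distance magic if and only if $n = 4n_0$ for some integer $n_0 \geq 2$ and at least one of the following holds: (A1) there exists $q \in \mathbb{Z}_n^*$ such that $qS = \{\pm 1, \pm n_0, \pm (2n_0-1)\}$; (A2) there exists $q \in \mathbb{Z}_n^*$ such that $qS = \{\pm 2, \pm n_0, \pm (2n_0-2)\}$; (A3) $n_0 = dd'$ for odd and coprime integers $d, d'$ with $1 < d < d' < n_0$, and there exists $q \in \mathbb{Z}_n^*$ such that $qS = \{\pm 2, \pm n_0, \pm c'\}$, where $1 < c' < n$ is the unique solution of the system $c' \equiv 0 \pmod 4$, $c' \equiv 2 \pmod d$, $c' \equiv -2 \pmod{d'}$; (A4) $n_0 = dd'd''$ for odd and pairwise coprime integers $d, d', d''$ with $1 \leq d < d' < d'' < n_0$, and there exists $q \in \mathbb{Z}_n^*$ such that $qS = \{\pm d, \pm b', \pm c'\}$, where $b'$ is the smallest integer with $1 < b' < n$ satisfying $b' \equiv 2-d \pmod 4$, $b' \equiv 0 \pmod{d'}$, $b' \equiv -d \pmod{d''}$ and $\gcd(b',d) = 1$, and where $1 < c' < n$ is the unique solution of the system $c' \equiv 2-d \pmod 4$, $c' \equiv -b' \pmod d$, $c' \equiv -d \pmod{d'}$, $c' \equiv 0 \pmod{d''}$.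 (B) If $n$ is not divisible by $4$, then $\Gamma$ is distance magic if and only if $n$ is odd, $n = 3n_0$ for some integer $n_0 \geq 3$, and at least one of the following holds: (B1) there exists $q \in \mathbb{Z}_n^*$ such that $qS = \{\pm 1, \pm (n_0-1), \pm (n_0+1)\}$; (B2) $n_0 = dd'$ for coprime integers $d$ and $d'$ with $1 < d < d'$, both of which are coprime to $3$, and, letting $\delta \in \{-1,1\}$ be such that $n_0 \equiv \delta \pmod 3$ and letting $c' \in \{1,2,\ldots,n-1\}$ be the unique solution of the system $c' \equiv 0 \pmod 3$, $c' \equiv 1 \pmod d$, $c' \equiv -1 \pmod{d'}$, there exists $q \in \mathbb{Z}_n^*$ such that $qS = \{\pm 1, \pm(n_0+\delta), \pm c'\}$.
   Context: $\mathbb{Z}_n$ is the ring of residue classes modulo $n$ (and its additive cyclic group), $\mathbb{Z}_n^*$ its group of units, $\langle S\rangle$ the additive subgroup generated by $S$, and $qS = \{qs : s \in S\}$. For $S \subset \mathbb{Z}_n$ with $S=-S$ and $0 \notin S$, the circulant $\mathrm{Circ}(n;S)$ is the graph with vertex set $\mathbb{Z}_n$ in which $i,j$ are adjacent iff $j-i \in S$. A graph $\Gamma=(V,E)$ of order $n$ is distance magic if there are a bijection $\ell\colon V \to \{1,\dots,n\}$ and a positive integer $\kappa$ with $\sum_{u \in N(v)} \ell(u) = \kappa$ for all $v \in V$, where $N(v)$ is the set of neighbors of $v$. *)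

(* Defs.v *)
From HB Require Import structures.
From mathcomp Require Import all_boot all_order all_fingroup all_algebra.

Set Implicit Arguments.
Unset Strict Implicit.
Unset Printing Implicit Defensive.

Import GRing.Theory.
Local Open Scope ring_scope.

(* A graph on a finite vertex type V is given by its adjacency relation e. *)
Definition neighbors (V : finType) (e : rel V) (v : V) : {set V} :=
  [set u | e v u].

(* The second conjunct says that the image of l is exactly {1, ..., #|V|}. *)
Definition distance_magic (V : finType) (e : rel V) : Prop :=
  exists (l : V -> nat) (kappa : nat),
    [/\ injective l,
        forall k : nat, (1 <= k <= #|V|)%N <-> exists v, l v = k,
        (0 < kappa)%N
      & forall v, (\sum_(u in neighbors e v) l u)%N = kappa].

(* 'Z_n is the ring of residues modulo n only when 1 < n. *)
Definition circ (n : nat) (S : {set 'Z_n}) : rel 'Z_n :=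
  fun i j => j - i \in S.

Lemma circ_sym (n : nat) (S : {set 'Z_n}) :
  (forall x, x \in S -> - x \in S) -> symmetric (circ S).
Proof.
move=> symS i j; rewrite /circ.
by apply/idP/idP => /symS; rewrite opprB.
Qed.

Lemma circ_irr (n : nat) (S : {set 'Z_n}) :
  0 \notin S -> irreflexive (circ S).
Proof. by move=> S0 i; rewrite /circ subrr; apply: negbTE. Qed.

Definition pm3 (n : nat) (x y z : 'Z_n) : {set 'Z_n} :=
  [set x; - x; y; - y; z; - z].

Definition unit_multiple (n : nat) (S T : {set 'Z_n}) : Prop :=
  exists2 q : 'Z_n, q \is a GRing.unit & [set q * s | s in S] = T.

(* Main.v *)
Require Import Defs.
From HB Require Import structures.
From mathcomp Require Import all_boot all_order all_fingroup all_algebra.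
From mathcomp Require Import all_field.
From mathcomp Require Import zify ring.

(* The labelling of a distance magic circulant is annihilated by convolution with
   S. If all characters killing S were trivial on the subgroup of order p, for a
   prime p dividing n, the labelling would have period n/p; so for each such p
   there is an n-th root of unity z, of order divisible by the full p-part of n,
   with u + v + t = 0 for u = z^a + z^-a, v = z^b + z^-b, t = z^c + z^-c.
   If 3 does not divide n, the Galois automorphism z |-> z^3 yields 3uvt = 0, so,
   up to permutation and signs, z^(2a) = -1 and z^(b+c) = -1. If n is odd,
   z |-> z^2 yields uv + vt + tu = -3, so that, up to signs, z^a, z^b, z^c are the
   distinct elements of a coset of the cube roots of unity. Read prime by prime,
   this information determines S up to a unit.
   Conversely, for each family the labelling is a mixed-radix number in the
   residues modulo the given divisors; each digit is annihilated by S on its own. *)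

Set Implicit Arguments.
Unset Strict Implicit.
Unset Printing Implicit Defensive.

Import Order.TTheory GRing.Theory Num.Theory.
Local Open Scope ring_scope.

(** * Circulants and labellings by integer functions *)

(** The root z is found for one prime p at a time, and nothing relates the roots of different
    primes: the roles of a, b, c and the signs may change with p. Grouping the primes of n0 by these
    choices is what produces the divisors d, d', d''. Two facts keep the choices compatible. Since S
    generates Z_n, no prime of n divides a, b and c together. And for every p the order N of z ties
    together the 2-adic (or 3-adic) valuations of the exponents, so the residues of a, b, c modulo 4
    (or 3) rule out most alternatives at all other primes. The root belonging to p = 2 (or p = 3) is
    therefore examined before the others. The elements of S are carried as integers, since the
    argument handles their divisibility by prime powers and their gcds with n0. If n is even but not
    divisible by 4, then z |-> z^2 is no automorphism; a parity count excludes these n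
    separately. *)

Lemma sum_neighbors n (S : {set 'Z_n}) (F : 'Z_n -> nat) v :
  (\sum_(u in neighbors (circ S) v) F u = \sum_(s in S) F (v + s)%R)%N.
Proof.
rewrite (reindex (fun s => v + s)) /=; last first.
  by exists (fun u => u - v) => u _; rewrite addrC ?addKr ?subrK.
by apply: eq_bigl => s; rewrite inE /circ addrAC subrr add0r.
Qed.

Lemma big_pm3 (R : Type) (idx : R) (op : Monoid.com_law idx) n (x y z : 'Z_n)
    (F : 'Z_n -> R) :
  #|pm3 x y z| = 6%N ->
  \big[op/idx]_(s in pm3 x y z) F s =
  \big[op/idx]_(s <- [:: x; - x; y; - y; z; - z]) F s.
Proof.
have mem_pm3 : pm3 x y z =i [:: x; - x; y; - y; z; - z].
  by move=> s; rewrite !inE -!orbA.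
move=> card6; have /card_uniqP uniq6 : #|[:: x; - x; y; - y; z; - z]| = 6%N.
  by rewrite -(eq_card mem_pm3).
rewrite (big_uniq _ uniq6); exact: eq_bigl.
Qed.

Lemma sum_pm3 (V : nmodType) n (x y z : 'Z_n) (F : 'Z_n -> V) :
  #|pm3 x y z| = 6%N ->
  \sum_(s in pm3 x y z) F s = F x + F (- x) + F y + F (- y) + F z + F (- z).
Proof. by move=> card6; rewrite (big_pm3 _ _ card6); rewrite !big_cons big_nil /= addr0 !addrA. Qed.

Lemma sumn_pm3 n (x y z : 'Z_n) (F : 'Z_n -> nat) :
  #|pm3 x y z| = 6%N ->
  (\sum_(s in pm3 x y z) F s = F x + F (- x) + F y + F (- y) + F z + F (- z))%N.
Proof. by move=> card6; rewrite (big_pm3 _ _ card6); rewrite !big_cons big_nil /= addn0 !addnA. Qed.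

Lemma pm3N1 n (x y z : 'Z_n) : pm3 (- x) y z = pm3 x y z.
Proof. by rewrite /pm3 opprK (setUC [set - x]). Qed.

Lemma pm3C12 n (x y z : 'Z_n) : pm3 x y z = pm3 y x z.
Proof. by apply/setP => s; rewrite !inE; do 6!case: (s == _). Qed.

Lemma pm3C13 n (x y z : 'Z_n) : pm3 x y z = pm3 z y x.
Proof. by apply/setP => s; rewrite !inE; do 6!case: (s == _). Qed.

Lemma pm3C23 n (x y z : 'Z_n) : pm3 x y z = pm3 x z y.
Proof. by apply/setP => s; rewrite !inE; do 6!case: (s == _). Qed.

Lemma imset_pm3 n (q x y z : 'Z_n) :
  [set q * s | s in pm3 x y z] = pm3 (q * x) (q * y) (q * z).
Proof. by rewrite /pm3 !imsetU !imset_set1 !mulrN. Qed.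

Lemma pm3_eqN n (x y z x' y' z' : 'Z_n) :
    (x' = x \/ x' = - x) -> (y' = y \/ y' = - y) -> (z' = z \/ z' = - z) ->
  pm3 x' y' z' = pm3 x y z.
Proof.
have N2 u v w : pm3 u (- v) w = pm3 u v w :> {set 'Z_n}.
  by rewrite pm3C12 pm3N1 pm3C12.
have N3 u v w : pm3 u v (- w) = pm3 u v w :> {set 'Z_n}.
  by rewrite pm3C13 pm3N1 pm3C13.
by case=> -> [] -> [] ->; rewrite ?pm3N1 ?N2 ?N3.
Qed.

Lemma card_unit_multiple n (S T : {set 'Z_n}) : unit_multiple S T -> #|T| = #|S|.
Proof. by case=> q uq <-; rewrite card_imset //; apply: mulrI. Qed.

Lemma distance_magic_unit_multiple n (S T : {set 'Z_n}) :
  unit_multiple S T -> distance_magic (circ T) -> distance_magic (circ S).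
Proof.
case=> q uq defT [l [kappa [l_inj l_im kappa_gt0 l_sum]]].
exists (fun v => l (q * v)), kappa; split=> //.
- by move=> u v /l_inj/(mulrI uq).
- move=> k; rewrite l_im; split=> [[v lv]|[v lv]]; last by exists (q * v).
  by exists (q^-1 * v); rewrite mulVKr.
move=> v; rewrite sum_neighbors -[RHS](l_sum (q * v)) sum_neighbors -defT.
rewrite big_imset /=; last by move=> u w _ _ /(mulrI uq).
by apply: eq_bigr => s _; rewrite mulrDr.
Qed.

Lemma intr_Zp_eq0 n (i : int) :
  (1 < n)%N -> (i%:~R == 0 :> 'Z_n) = (n%:Z %| i)%Z.
Proof.
move=> n_gt1; have E k : (k%:R == 0 :> 'Z_n) = (n %| k)%N.
  by rewrite -val_eqE /= val_Zp_nat.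
case: i => k; first by rewrite -pmulrn E.
by rewrite NegzE mulrNz oppr_eq0 -pmulrn E dvdzE abszN.
Qed.

Lemma eq_intr_Zp n (i j : int) :
  (1 < n)%N -> (i%:~R == j%:~R :> 'Z_n) = (n%:Z %| i - j)%Z.
Proof. by move=> n_gt1; rewrite -subr_eq0 -intrB intr_Zp_eq0. Qed.

Lemma Zp_intr n (x : 'Z_n) : (x : nat)%:Z%:~R = x.
Proof. by rewrite -pmulrn natr_Zp. Qed.

Lemma unit_intr_Zp n (i : int) :
  (1 < n)%N -> (i%:~R : 'Z_n) \is a GRing.unit = coprimez n%:Z i.
Proof.
move=> n_gt1; case: i => k; first by rewrite -pmulrn unitZpE.
by rewrite NegzE mulrNz unitrN -pmulrn unitZpE // coprimezE abszN.
Qed.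

(** The function [g] is the centred labelling 2l - (n + 1). Its values have the parity of n + 1 and
    lie strictly between -n and n, which leaves exactly n of them, so injectivity modulo n makes l a
    bijection. Centring turns constant sums, with kappa = 3(n + 1), into vanishing sums: a linear
    condition that can be checked digit by digit. *)
Lemma distance_magic_int n (A B C : int) (g : int -> int) :
    (1 < n)%N -> #|pm3 (A%:~R : 'Z_n) B%:~R C%:~R| = 6%N ->
    (forall x y, (n%:Z %| x - y)%Z -> g x = g y) ->
    (forall x y, g x = g y -> (n%:Z %| x - y)%Z) ->
    (forall x, `|g x| < n%:Z) -> (forall x, (2 %| g x + n%:Z + 1)%Z) ->
    (forall x, g (x + A) + g (x - A) + g (x + B) + g (x - B)
               + g (x + C) + g (x - C) = 0) ->
  distance_magic (circ (pm3 (A%:~R : 'Z_n) B%:~R C%:~R)).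
Proof.
move=> n_gt1 card6 g_per g_inj g_bd g_odd g_sum.
pose l (v : 'Z_n) := `|((g (v : nat)%:Z + n%:Z + 1) %/ 2)%Z|%N.
have lE v : ((l v)%:Z * 2 = g (v : nat)%:Z + n%:Z + 1).
  by move: (g_bd (v : nat)%:Z) (g_odd (v : nat)%:Z); rewrite /l; lia.
have l_inj : injective l.
  move=> u v luv; have /g_inj : g (u : nat)%:Z = g (v : nat)%:Z.
    by move: (lE u) (lE v); rewrite luv; lia.
  by rewrite -eq_intr_Zp // !Zp_intr => /eqP.
have l_bd v : (1 <= l v <= n)%N.
  by move: (lE v) (g_bd (v : nat)%:Z) (g_odd (v : nat)%:Z); lia.
have cardZ : #|'Z_n| = n by rewrite card_ord Zp_cast.
exists l, (3 * (n + 1))%N; split=> //; last 2 first.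
- by rewrite muln_gt0 addn1.
- move=> v; rewrite sum_neighbors (sumn_pm3 _ card6).
  have lD (i : int) : (l (v + i%:~R))%:Z * 2 = g ((v : nat)%:Z + i) + n%:Z + 1.
    rewrite lE; congr (_ + _ + _); apply: g_per.
    by rewrite -eq_intr_Zp // Zp_intr intrD Zp_intr.
  have := g_sum (v : nat)%:Z; rewrite -!mulrNz.
  move: (lD A) (lD B) (lD C) (lD (- A)) (lD (- B)) (lD (- C)).
  set l1 := l _; set l2 := l _; set l3 := l _.
  set l4 := l _; set l5 := l _; set l6 := l _.
  set g1 := g _; set g2 := g _; set g3 := g _.
  set g4 := g _; set g5 := g _; set g6 := g _.
  by move: l1 l2 l3 l4 l5 l6 g1 g2 g3 g4 g5 g6; lia.
move=> k; split=> [kn | [v <-]]; last by rewrite cardZ.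
have mem_l : [seq l v | v : 'Z_n] =i iota 1 n.
  apply: (uniq_min_size _ _ _).2.
  - by rewrite map_inj_uniq ?enum_uniq.
  - by move=> _ /mapP[v _ ->]; rewrite mem_iota add1n ltnS.
  - by rewrite size_iota size_map -cardE cardZ.
have : k \in iota 1 n by rewrite mem_iota add1n ltnS -cardZ.
by rewrite -mem_l => /mapP[v _ ->]; exists v.
Qed.

(** * Labellings for n = 4 n0 *)

Lemma eq_digit (d r r' q q' : int) :
    0 <= r < d -> 0 <= r' < d -> r + d * q = r' + d * q' ->
  r = r' /\ q = q'.
Proof.
move=> r_d r'_d E; have Eq : q = q' by nia.
by split=> //; move: E; rewrite Eq => /addIr.
Qed.

Lemma dvdz_modz_eq (d x y : int) : (d %| x - y)%Z -> (x %% d = y %% d)%Z.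
Proof. by rewrite -eqz_mod_dvd => /eqP. Qed.

(** A shift by n/2 negates the centred labelling: [g] runs through 1, 3, ..., n - 1 on the first
    half of the residues and through their negatives on the second. By hypothesis x + A and x - A
    differ by n/2 modulo n, and so do x + B and x - C, and x + C and x - B; each pair cancels. *)
Lemma distance_magic_antiperiodic n n0 (A B C : int) :
    n = (4 * n0)%N -> (0 < n0)%N -> (n%:Z %| 2 * A - 2 * n0%:Z)%Z ->
    (n%:Z %| B + C - 2 * n0%:Z)%Z ->
    #|pm3 (A%:~R : 'Z_n) B%:~R C%:~R| = 6%N ->
  distance_magic (circ (pm3 (A%:~R : 'Z_n) B%:~R C%:~R)).
Proof.
move=> n4 n0_gt0 dvdA dvdBC card6.
pose g (x : int) : int := let r := (x %% n%:Z)%Z in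
  if r < 2 * n0%:Z then 2 * r + 1 else - (2 * (r - 2 * n0%:Z) + 1).
have rE x : exists r q, [/\ (x %% n%:Z)%Z = r, 0 <= r < 4 * n0%:Z & x = q * n%:Z + r].
  exists (x %% n%:Z)%Z, (x %/ n%:Z)%Z; split; first by []; last exact: divz_eq.
  by lia.
have g_per (x y : int) : (n%:Z %| x - y)%Z -> g x = g y.
  by move=> /dvdz_modz_eq E; rewrite /g E.
have g_anti (x y : int) : (n%:Z %| x - y - 2 * n0%:Z)%Z -> g x = - g y.
  move=> dvd; rewrite (g_per x (y + 2 * n0%:Z)); last by rewrite opprD addrA.
  rewrite /g; have [r [q [-> r_bd yE]]] := rE y.
  case: (ltP r) => r_lt.
    have -> : ((y + 2 * n0%:Z) %% n%:Z)%Z = r + 2 * n0%:Z.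
      by rewrite yE -addrA modzMDl modz_small //; lia.
    by case: ltP; lia.
  have -> : ((y + 2 * n0%:Z) %% n%:Z)%Z = r - 2 * n0%:Z.
    have -> : y + 2 * n0%:Z = (q + 1) * n%:Z + (r - 2 * n0%:Z) by lia.
    by rewrite modzMDl modz_small //; lia.
  by case: ltP; lia.
apply: (@distance_magic_int _ A B C g) => //; first by lia.
- move=> x y; rewrite /g; have [r [q [-> r_bd ->]]] := rE x.
  have [r' [q' [-> r'_bd ->]]] := rE y => E.
  have -> : q * n%:Z + r - (q' * n%:Z + r') = (q - q') * n%:Z + (r - r') by ring.
  have -> : r - r' = 0 by move: E; do 2!case: ltP => ?; lia.
  by rewrite addr0 dvdz_mull.
- by move=> x; rewrite /g; have [r [q [-> r_bd _]]] := rE x; case: ifP => ?; lia.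
- by move=> x; rewrite /g; have [r [q [-> r_bd _]]] := rE x; case: ltP; lia.
move=> x; rewrite (g_anti (x + A) (x - A)); last by apply: etrans dvdA; congr (_ %| _)%Z; ring.
rewrite (g_anti (x + B) (x - C)); last by apply: etrans dvdBC; congr (_ %| _)%Z; ring.
rewrite (g_anti (x + C) (x - B)); last by apply: etrans dvdBC; congr (_ %| _)%Z; ring.
by ring.
Qed.

(** Using the hypothesis on f twice gives f the period 4D. For D odd, a sign depending on x mod 4
    times a digit depending on x mod D is such an f, so this is the condition that each modulus of
    the mixed-radix labelling has to meet on its own. *)
Definition antiperiodic_sum0 (D : nat) (A B C : int) :=
  forall f : int -> int,
    (forall x y, ((4 * D)%N%:Z %| x - y - 2 * D%:Z)%Z -> f x = - f y) ->
  forall x, f (x + A) + f (x - A) + f (x + B) + f (x - B)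
            + f (x + C) + f (x - C) = 0.

Lemma antiperiodic_sum0_pair (D : nat) (A B C : int) :
    ((4 * D)%N%:Z %| 2 * A - 2 * D%:Z)%Z ->
    ((4 * D)%N%:Z %| B + C - 2 * D%:Z)%Z ->
  antiperiodic_sum0 D A B C.
Proof.
move=> dvdA dvdBC f f_anti x.
rewrite (f_anti (x + A) (x - A)); last by apply: etrans dvdA; congr (_ %| _)%Z; ring.
rewrite (f_anti (x + B) (x - C)); last by apply: etrans dvdBC; congr (_ %| _)%Z; ring.
rewrite (f_anti (x + C) (x - B)); last by apply: etrans dvdBC; congr (_ %| _)%Z; ring.
by ring.
Qed.

Lemma antiperiodic_sum0C12 D A B C :
  antiperiodic_sum0 D A B C -> antiperiodic_sum0 D B A C.
Proof. by move=> H f f_anti x; rewrite -[RHS](H f f_anti x); ring. Qed.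

Lemma antiperiodic_sum0C13 D A B C :
  antiperiodic_sum0 D A B C -> antiperiodic_sum0 D C B A.
Proof. by move=> H f f_anti x; rewrite -[RHS](H f f_anti x); ring. Qed.

Lemma antiperiodic_sum0N3 D A B C :
  antiperiodic_sum0 D A B C -> antiperiodic_sum0 D A B (- C).
Proof.
by move=> H f f_anti x; rewrite -[RHS](H f f_anti x) opprK; ring.
Qed.

Lemma coprime_odd_4 d : odd d -> coprime 4 d.
Proof. by move=> d_odd; rewrite (@coprime_pexpl 2 2) // coprime2n. Qed.

Lemma dvdz_4mul3 (d d' d'' : nat) (x : int) :
    odd d -> odd d' -> odd d'' ->
    coprime d d' -> coprime d d'' -> coprime d' d'' ->
  ((4 * (d * d' * d''))%N%:Z %| x)%Z =
  [&& (4 %| x)%Z, (d%:Z %| x)%Z, (d'%:Z %| x)%Z & (d''%:Z %| x)%Z].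
Proof.
move=> *; rewrite !PoszM !Gauss_dvdz -?andbA //.
- by rewrite coprimezE abszM coprimeMl; apply/andP.
- by rewrite coprimezE !abszM !coprimeMr !coprime_odd_4.
Qed.

(* The label of x is a sign depending on x mod 4 times an odd number whose
   mixed-radix digits are x mod d, x mod d', x mod d'' and x mod 2. *)
Lemma distance_magic_mixed_radix n (d d' d'' : nat) (A B C : int) :
    n = (4 * (d * d' * d''))%N -> [/\ odd d, odd d' & odd d''] ->
    [/\ coprime d d', coprime d d'' & coprime d' d''] ->
    antiperiodic_sum0 d A B C -> antiperiodic_sum0 d' A B C ->
    d'' = 1%N \/ antiperiodic_sum0 d'' A B C ->
    #|pm3 (A%:~R : 'Z_n) B%:~R C%:~R| = 6%N ->
  distance_magic (circ (pm3 (A%:~R : 'Z_n) B%:~R C%:~R)).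
Proof.
move=> nE [odd_d odd_d' odd_d''] [co1 co2 co3] sum0 sum0' sum0'' card6.
have dvd_n x : (n%:Z %| x)%Z =
    [&& (4 %| x)%Z, (d%:Z %| x)%Z, (d'%:Z %| x)%Z & (d''%:Z %| x)%Z].
  by rewrite nE dvdz_4mul3.
pose s (x : int) : int := if (x %% 4)%Z < 2 then 1 else - 1.
pose b (x : int) : int := (x %% 2)%Z.
pose r (e : nat) (x : int) : int := (x %% e%:Z)%Z.
(* The bit and the constant 1 are unchanged by a shift of 2d, so they can go with the digit modulo
   d. They are kept out of [g3], which must vanish when d'' = 1, where no annihilation is
   assumed. *)
pose g1 (x : int) : int := s x * (2 * (d%:Z * (d'%:Z * (d''%:Z * b x)) + r d x) + 1).
pose g2 (x : int) : int := s x * (2 * d%:Z * r d' x).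
pose g3 (x : int) : int := s x * (2 * d%:Z * d'%:Z * r d'' x).
pose F (x : int) : int := r d x + d%:Z * (r d' x + d'%:Z * (r d'' x + d''%:Z * b x)).
pose g (x : int) : int := s x * (2 * F x + 1).
have gE x : g x = g1 x + g2 x + g3 x.
  by rewrite /g /g1 /g2 /g3 /F; ring.
have sb_anti (x y : int) : (4 %| x - y - 2)%Z -> s x = - s y /\ b x = b y.
  by rewrite /s /b => dvd; split; [do 2!case: ltP => ?|]; lia.
(* For e odd, 2e is 2 modulo 4: a shift by 2e flips the sign and keeps both the parity and the
   residue modulo e. *)
have anti (e : nat) (x y : int) : odd e -> ((4 * e)%N%:Z %| x - y - 2 * e%:Z)%Z ->
    [/\ s x = - s y, b x = b y & r e x = r e y].
  move=> odd_e dvd.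
  have [-> ->] : s x = - s y /\ b x = b y.
    apply: sb_anti; have : (4 %| x - y - 2 * e%:Z)%Z.
      by apply: dvdz_trans dvd; rewrite PoszM dvdz_mulr.
    by lia.
  split=> //; apply: dvdz_modz_eq.
  have : (e%:Z %| x - y - 2 * e%:Z)%Z.
    by apply: dvdz_trans dvd; rewrite PoszM dvdz_mull.
  by move=> dvd_e; rewrite -[x - y](subrK (2 * e%:Z)) rpredD // dvdz_mull.
have [d_gt0 d'_gt0 d''_gt0] : [/\ (0 < d)%N, (0 < d')%N & (0 < d'')%N].
  by split; apply: odd_gt0.
have r_bd (e : nat) x : (0 < e)%N -> 0 <= r e x < e%:Z.
  by move=> e_gt0; rewrite modz_ge0 ?ltz_pmod //; lia.
have b_bd x : 0 <= b x < 2 by rewrite /b; lia.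
have s_pm x : s x = 1 \/ s x = - 1 by rewrite /s; case: ltP; auto.
have bd_step (e : nat) (u t : int) (m : nat) : 0 <= u < e%:Z -> 0 <= t < m%:Z ->
  0 <= u + e%:Z * t < (e * m)%N%:Z by nia.
have F_bd x : 0 <= F x < (d * (d' * (d'' * 2)))%N%:Z.
  rewrite /F; apply: (bd_step _ _ _ _ (r_bd _ _ d_gt0)).
  apply: (bd_step _ _ _ _ (r_bd _ _ d'_gt0)).
  exact: (bd_step _ _ _ _ (r_bd _ _ d''_gt0) (b_bd x)).
apply: (@distance_magic_int _ A B C g) => //.
- by rewrite nE; nia.
- move=> x y; rewrite dvd_n => /and4P[dvd4 dvdd dvdd' dvdd''].
  rewrite /g /F /r (dvdz_modz_eq dvdd) (dvdz_modz_eq dvdd') (dvdz_modz_eq dvdd'').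
  have -> : s x = s y by rewrite /s; do 2!case: ltP => ?; lia.
  by have -> : b x = b y by rewrite /b; lia.
(* Since 2F + 1 is positive, [g] determines both the sign and [F]. *)
- move=> x y E; have [Es EF] : s x = s y /\ F x = F y.
    move: E; rewrite /g; move: (F_bd x) (F_bd y).
    by case: (s_pm x) => ->; case: (s_pm y) => ->; lia.
  have [Er1 /eq_digit-/(_ _ _)] := eq_digit (r_bd _ _ d_gt0) (r_bd _ _ d_gt0) EF.
  rewrite !r_bd // => /(_ isT isT)[Er2 /eq_digit].
  rewrite !r_bd // => /(_ isT isT)[Er3 Eb].
  rewrite dvd_n -!eqz_mod_dvd; apply/and4P; split; last 3 first.
  + exact/eqP.
  + exact/eqP.
  + exact/eqP.
  (* The sign separates {0, 1} from {2, 3} and the bit gives the parity; together they determine x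
     mod 4. *)
  by move: Es Eb; rewrite /s /b; do 2!case: ltP => ?; lia.
- move=> x; move: (F_bd x); rewrite /g nE.
  by case: (s_pm x) => ->; lia.
- by move=> x; rewrite /g nE; case: (s_pm x) => ->; lia.
move=> x; rewrite !gE.
have g1_anti u v : ((4 * d)%N%:Z %| u - v - 2 * d%:Z)%Z -> g1 u = - g1 v.
  by move=> /(anti _ _ _ odd_d)[E1 E2 E3]; rewrite /g1 E1 E2 E3 mulNr.
have g2_anti u v : ((4 * d')%N%:Z %| u - v - 2 * d'%:Z)%Z -> g2 u = - g2 v.
  by move=> /(anti _ _ _ odd_d')[E1 E2 E3]; rewrite /g2 E1 E3 mulNr.
have g3_anti u v : ((4 * d'')%N%:Z %| u - v - 2 * d''%:Z)%Z -> g3 u = - g3 v.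
  by move=> /(anti _ _ _ odd_d'')[E1 E2 E3]; rewrite /g3 E1 E3 mulNr.
have sum3 : g3 (x + A) + g3 (x - A) + g3 (x + B) + g3 (x - B)
            + g3 (x + C) + g3 (x - C) = 0.
  case: sum0'' => [d''1 | sum0'']; last exact: sum0''.
  by rewrite /g3 /r d''1 !modz1 !mulr0.
have := sum0 g1 g1_anti x; have := sum0' g2 g2_anti x; move: sum3.
move=> E3 E2 E1; have := congr2 +%R (congr2 +%R E1 E2) E3.
by rewrite !addr0 => <-; ring.
Qed.

(** * Labellings for n = 3 n0 *)

Lemma odd_halfE d : odd d -> d = (2 * d./2 + 1)%N.
Proof. by lia. Qed.

Lemma modz_bound (d : nat) (x : int) : (0 < d)%N -> 0 <= (x %% d%:Z)%Z < d%:Z.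
Proof. by move=> d_gt0; rewrite modz_ge0 ?ltz_pmod //; lia. Qed.

Lemma dvdz_oppr (d x : int) : (d %| - x)%Z = (d %| x)%Z.
Proof. by rewrite !dvdzE abszN. Qed.

(* A Kotzig array: each row x mod 3 maps [0, 2m] bijectively onto [-m, m], and the
   three rows add up to 0. *)
Definition kotzig (m : nat) (x y : int) : int :=
  let r := (x %% 3)%Z in
  let u := if y <= m%:Z then y else y - (2 * m + 1)%N%:Z in
  if r == 0 then y - m%:Z else if r == 1 then u else m%:Z - y - u.

(* All 3(2m+1) entries are distinct, and each column adds up to 0. *)
Definition kotzig3 (m : nat) (x y : int) : int :=
  ((x %% 3)%Z - 1) * (2 * m + 1)%N%:Z + kotzig m x y.

Lemma kotzig_bound m x y :
  0 <= y < (2 * m + 1)%N%:Z -> - m%:Z <= kotzig m x y <= m%:Z.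
Proof. by rewrite /kotzig; do ?case: ifP => ?; lia. Qed.

Lemma kotzig_inj m x x' y y' :
    0 <= y < (2 * m + 1)%N%:Z -> 0 <= y' < (2 * m + 1)%N%:Z ->
    (x = x' %[mod 3])%Z -> kotzig m x y = kotzig m x' y' ->
  y = y'.
Proof. by rewrite /kotzig => ? ? ->; do ?case: ifP => ?; lia. Qed.

Lemma kotzig_sum m x x' x'' y :
    (x != x' %[mod 3])%Z -> (x != x'' %[mod 3])%Z -> (x' != x'' %[mod 3])%Z ->
  kotzig m x y + kotzig m x' y + kotzig m x'' y = 0.
Proof.
by rewrite /kotzig => *; do ?case: ifP => ?; lia.
Qed.

Lemma kotzig3_bound m x y :
    0 <= y < (2 * m + 1)%N%:Z ->
  - (3 * m + 1)%N%:Z <= kotzig3 m x y <= (3 * m + 1)%N%:Z.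
Proof. by move=> /(kotzig_bound x); rewrite /kotzig3; nia. Qed.

Lemma kotzig3_inj m x x' y y' :
    0 <= y < (2 * m + 1)%N%:Z -> 0 <= y' < (2 * m + 1)%N%:Z ->
    kotzig3 m x y = kotzig3 m x' y' ->
  (x = x' %[mod 3])%Z /\ y = y'.
Proof.
rewrite /kotzig3 => y_bd y'_bd E.
have /eq_digit : kotzig m x y + m%:Z + (2 * m + 1)%N%:Z * (x %% 3)%Z =
                 kotzig m x' y' + m%:Z + (2 * m + 1)%N%:Z * (x' %% 3)%Z.
  by move: E; nia.
case; first by move: (kotzig_bound x y_bd); lia.
  by move: (kotzig_bound x' y'_bd); lia.
by move=> /addIr Ek Ex; split; last exact: kotzig_inj Ex Ek.
Qed.

Lemma kotzig3_sum m x x' x'' y :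
    (x != x' %[mod 3])%Z -> (x != x'' %[mod 3])%Z -> (x' != x'' %[mod 3])%Z ->
  kotzig3 m x y + kotzig3 m x' y + kotzig3 m x'' y = 0.
Proof.
move=> n1 n2 n3; have := kotzig_sum m y n1 n2 n3; rewrite /kotzig3.
(* Three distinct residues modulo 3 add up to 3, so the row offsets, each lowered by 1, cancel. *)
have -> : (x'' %% 3)%Z = 3 - (x %% 3)%Z - (x' %% 3)%Z by lia.
by nia.
Qed.

(** S is the union of the cosets of the subgroup of order 3 through 1 and -1. Each such coset is a
    column of the array: the column is x mod n0 and the row is the quotient of x by n0, taken modulo
    3. The row cannot be x mod 3, because n0 may be divisible by 3. The factor 2 is there because
    centred labels are even when n is odd. *)
Lemma distance_magic_coset3 n n0 (A B C : int) :
    n = (3 * n0)%N -> odd n0 -> (1 < n)%N ->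
    A = 1 -> B = n0%:Z - 1 -> C = n0%:Z + 1 ->
    #|pm3 (A%:~R : 'Z_n) B%:~R C%:~R| = 6%N ->
  distance_magic (circ (pm3 (A%:~R : 'Z_n) B%:~R C%:~R)).
Proof.
move=> nE odd_n0 n_gt1 AE BE CE card6; pose m := n0./2.
have n0E : n0 = (2 * m + 1)%N by exact: odd_halfE.
pose g (x : int) : int := 2 * kotzig3 m (x %/ n0%:Z)%Z (x %% n0%:Z)%Z.
have modE x : exists r q : int, [/\ (x %% n0%:Z)%Z = r, (x %/ n0%:Z)%Z = q,
    0 <= r < (2 * m + 1)%N%:Z & x = q * n0%:Z + r].
  exists (x %% n0%:Z)%Z, (x %/ n0%:Z)%Z; split; rewrite -?divz_eq //.
  by rewrite -n0E; lia.
have shift (x k : int) :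
    g (x + k * n0%:Z) = 2 * kotzig3 m ((x %/ n0%:Z)%Z + k) (x %% n0%:Z)%Z.
  by rewrite /g addrC modzMDl divzMDl 1?addrC //; lia.
have coset (x y : int) : (n%:Z %| x - y)%Z -> g x = g y.
  move=> /dvdzP[k E]; have -> : x = y + (3 * k) * n0%:Z by move: E; rewrite nE; nia.
  rewrite shift /g /kotzig3 /kotzig.
  by have -> : (((y %/ n0%:Z)%Z + 3 * k) %% 3)%Z = ((y %/ n0%:Z)%Z %% 3)%Z by lia.
have sum3 (x : int) : g x + g (x + n0%:Z) + g (x - n0%:Z) = 0.
  have := shift x 1; have := shift x (- 1); rewrite mulN1r mul1r => -> ->.
  rewrite {1}/g -!mulrDr kotzig3_sum ?mulr0 //; lia.
apply: (@distance_magic_int _ A B C g) => //.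
- move=> x y; rewrite /g.
  have [r [q [-> -> r_bd ->]]] := modE x; have [r' [q' [-> -> r'_bd ->]]] := modE y.
  move=> E; have [Eq ->] : (q = q' %[mod 3])%Z /\ r = r'.
    by apply: kotzig3_inj r_bd r'_bd _; apply: mulfI E.
  rewrite nE; have /dvdzP[k qE] : (3 %| q - q')%Z by lia.
  apply/dvdzP; exists k.
  have -> : q * n0%:Z + r' - (q' * n0%:Z + r') = (q - q') * n0%:Z by ring.
  by rewrite qE; lia.
- move=> x; rewrite /g; have [r [q [-> -> r_bd _]]] := modE x.
  by move: (kotzig3_bound q r_bd); lia.
- by move=> x; rewrite /g; lia.
move=> x; rewrite AE BE CE; have := congr2 +%R (sum3 (x + 1)) (sum3 (x - 1)).
rewrite addr0 => E; rewrite -[RHS]E.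
have -> : x + (n0%:Z - 1) = x - 1 + n0%:Z by ring.
have -> : x - (n0%:Z - 1) = x + 1 - n0%:Z by ring.
have -> : x + (n0%:Z + 1) = x + 1 + n0%:Z by ring.
have -> : x - (n0%:Z + 1) = x - 1 - n0%:Z by ring.
by ring.
Qed.

Lemma dvdz_3mul2 (d d' : nat) (x : int) :
    coprime d d' -> coprime d 3 -> coprime d' 3 ->
  ((3 * (d * d'))%N%:Z %| x)%Z = [&& (3 %| x)%Z, (d%:Z %| x)%Z & (d'%:Z %| x)%Z].
Proof.
move=> co1 co2 co3; rewrite !PoszM !Gauss_dvdz //.
by rewrite coprimezE !abszM coprimeMr !(coprime_sym 3); apply/andP.
Qed.

Lemma mixed_bound (m m' : nat) (u v : int) :
    - m%:Z <= u <= m%:Z -> - (3 * m' + 1)%N%:Z <= v <= (3 * m' + 1)%N%:Z ->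
  `|2 * (u + (2 * m + 1)%N%:Z * v)| < (3 * ((2 * m + 1) * (2 * m' + 1)))%N%:Z.
Proof. by nia. Qed.

(** Both digits use the row x mod 3. The columns are x mod d for the low digit, which is annihilated
    by {A, B, C} and by its negative, and x mod d' for the high digit, which is annihilated by {A,
    B, -C} and by its negative. As 3 divides C, changing its sign keeps the rows distinct. The high
    digit already determines the row, so the low one only has to be injective along each row, which
    lets its values repeat between rows. *)
Lemma distance_magic_kotzig2 n (d d' : nat) (A B C : int) :
    n = (3 * (d * d'))%N -> odd d -> odd d' -> (1 < n)%N ->
    coprime d d' -> coprime d 3 -> coprime d' 3 ->
    (A != B %[mod 3])%Z -> (A != C %[mod 3])%Z -> (B != C %[mod 3])%Z ->
    (3 %| C)%Z ->
    (d%:Z %| A - B)%Z -> (d%:Z %| A - C)%Z ->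
    (d'%:Z %| A - B)%Z -> (d'%:Z %| A + C)%Z ->
    #|pm3 (A%:~R : 'Z_n) B%:~R C%:~R| = 6%N ->
  distance_magic (circ (pm3 (A%:~R : 'Z_n) B%:~R C%:~R)).
Proof.
move=> nE odd_d odd_d' n_gt1 co1 co2 co3 nAB nAC nBC C3.
have dvd_n x : (n%:Z %| x)%Z = [&& (3 %| x)%Z, (d%:Z %| x)%Z & (d'%:Z %| x)%Z].
  by rewrite nE dvdz_3mul2.
pose m := d./2; have dE : d = (2 * m + 1)%N by exact: odd_halfE.
pose m' := d'./2; have d'E : d' = (2 * m' + 1)%N by exact: odd_halfE.
pose g1 (x : int) : int := kotzig m x (x %% d%:Z)%Z.
pose g2 (x : int) : int := kotzig3 m' x (x %% d'%:Z)%Z.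
pose g (x : int) : int := 2 * (g1 x + d%:Z * g2 x).
have modd x : 0 <= (x %% d%:Z)%Z < (2 * m + 1)%N%:Z.
  by rewrite -dE modz_bound // odd_gt0.
have modd' x : 0 <= (x %% d'%:Z)%Z < (2 * m' + 1)%N%:Z.
  by rewrite -d'E modz_bound // odd_gt0.
have g1_sum (u v w : int) : (u != v %[mod 3])%Z -> (u != w %[mod 3])%Z ->
    (v != w %[mod 3])%Z -> (d%:Z %| u - v)%Z -> (d%:Z %| u - w)%Z ->
    g1 u + g1 v + g1 w = 0.
  move=> ? ? ? /dvdz_modz_eq Ev /dvdz_modz_eq Ew.
  by rewrite /g1 -Ev -Ew kotzig_sum.
have g2_sum (u v w : int) : (u != v %[mod 3])%Z -> (u != w %[mod 3])%Z ->
    (v != w %[mod 3])%Z -> (d'%:Z %| u - v)%Z -> (d'%:Z %| u - w)%Z ->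
    g2 u + g2 v + g2 w = 0.
  move=> ? ? ? /dvdz_modz_eq Ev /dvdz_modz_eq Ew.
  by rewrite /g2 -Ev -Ew kotzig3_sum.
have g1_bd x : - m%:Z <= g1 x <= m%:Z by exact: kotzig_bound.
have g2_bd x : - (3 * m' + 1)%N%:Z <= g2 x <= (3 * m' + 1)%N%:Z.
  exact: kotzig3_bound.
have g1_ge0 x : 0 <= g1 x + m%:Z < d%:Z.
  by move: (g1_bd x); rewrite [in X in _ < X]dE; lia.
have g_per (x y : int) : (n%:Z %| x - y)%Z -> g x = g y.
  rewrite dvd_n => /and3P[dvd3 /dvdz_modz_eq Ed /dvdz_modz_eq Ed'].
  rewrite /g /g1 /g2 /kotzig3 /kotzig Ed Ed'.
  by have -> // : (x %% 3)%Z = (y %% 3)%Z by exact: dvdz_modz_eq.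
have g_inj (x y : int) : g x = g y -> (n%:Z %| x - y)%Z.
  move=> E.
  have /eq_digit[] : g1 x + m%:Z + d%:Z * g2 x = g1 y + m%:Z + d%:Z * g2 y.
  - by rewrite addrAC (mulfI _ E) // addrAC.
  - exact: g1_ge0.
  - exact: g1_ge0.
  move=> /addIr E1 /(kotzig3_inj (modd' x) (modd' y))[Ex E2].
  have E1' := kotzig_inj (modd x) (modd y) Ex E1.
  by rewrite dvd_n -!eqz_mod_dvd; apply/and3P; split; apply/eqP.
have g_bd (x : int) : `|g x| < n%:Z.
  by rewrite /g nE dE d'E; apply: mixed_bound.
have g_odd (x : int) : (2 %| g x + n%:Z + 1)%Z.
  have odd_n : odd n by rewrite nE !oddM odd_d odd_d'.
  by rewrite /g; lia.
have neq_shift (x u v : int) : (u != v %[mod 3])%Z -> (x + u != x + v %[mod 3])%Z.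
  by lia.
have neq_opp (u v : int) : (u != v %[mod 3])%Z -> (- u != - v %[mod 3])%Z.
  by lia.
have neqN (u : int) : (u != C %[mod 3])%Z -> (u != - C %[mod 3])%Z by lia.
have neqN' (u : int) : (u != C %[mod 3])%Z -> (- u != C %[mod 3])%Z by lia.
move=> dAB dAC d'AB d'AC card6.
apply: (@distance_magic_int _ A B C g) => //.
move=> x.
have s1 : g1 (x + A) + g1 (x + B) + g1 (x + C) = 0.
  apply: g1_sum; auto.
    by apply: etrans dAB; congr (_ %| _)%Z; ring.
  by apply: etrans dAC; congr (_ %| _)%Z; ring.
have s2 : g1 (x - A) + g1 (x - B) + g1 (x - C) = 0.
  apply: g1_sum; auto.
    by rewrite -dvdz_oppr; apply: etrans dAB; congr (_ %| _)%Z; ring.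
  by rewrite -dvdz_oppr; apply: etrans dAC; congr (_ %| _)%Z; ring.
have s3 : g2 (x + A) + g2 (x + B) + g2 (x - C) = 0.
  apply: g2_sum; auto.
    by apply: etrans d'AB; congr (_ %| _)%Z; ring.
  by apply: etrans d'AC; congr (_ %| _)%Z; ring.
have s4 : g2 (x - A) + g2 (x - B) + g2 (x + C) = 0.
  apply: g2_sum; auto.
    by rewrite -dvdz_oppr; apply: etrans d'AB; congr (_ %| _)%Z; ring.
  by rewrite -dvdz_oppr; apply: etrans d'AC; congr (_ %| _)%Z; ring.
rewrite /g; transitivity (2 * ((g1 (x + A) + g1 (x + B) + g1 (x + C))
  + (g1 (x - A) + g1 (x - B) + g1 (x - C))
  + d%:Z * ((g2 (x + A) + g2 (x + B) + g2 (x - C))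
    + (g2 (x - A) + g2 (x - B) + g2 (x + C))))); first by ring.
by rewrite s1 s2 s3 s4; ring.
Qed.

(** * Characters and vanishing sums of cosines *)

Lemma expr_Zp_add (R : nzRingType) n (z : R) (x y : 'Z_n) :
  (1 < n)%N -> z ^+ n = 1 -> z ^+ (x + y)%R = z ^+ x * z ^+ y.
Proof.
by move=> n_gt1 zn1; rewrite -exprD -(expr_mod (x + y)%N zn1) /= [X in (_ %% X)%N]Zp_cast.
Qed.

(** The transform is the polynomial with coefficients [g], of degree below n, evaluated at the n-th
    roots of unity; with n distinct roots it is zero. *)
Lemma fourier_eq0 n (g : 'Z_n -> algC) :
    (1 < n)%N ->
    (forall z : algC, z ^+ n = 1 -> \sum_v g v * z ^+ (v : nat) = 0) ->
  forall v, g v = 0.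
Proof.
move=> n_gt1 g_hat0 v; have n_gt0 := ltnW n_gt1.
pose P : {poly algC} := \sum_(u : 'Z_n) g u *: 'X^u.
have sizeP : (size P <= n)%N.
  apply: (big_ind (fun Q : {poly algC} => (size Q <= n)%N)).
  - by rewrite size_poly0.
  - by move=> Q Q' ? ?; rewrite (leq_trans (size_polyD _ _)) // geq_max; apply/andP.
  move=> u _; rewrite (leq_trans (size_scale_leq _ _)) // size_polyXn.
  by have := ltn_ord u; rewrite [X in (_ < X)%N]Zp_cast.
have [w w_prim] := C_prim_root_exists n_gt0.
have P0 : P = 0.
  apply/eqP; apply: contraT => nzP.
  have := max_poly_roots (rs := [seq w ^+ i | i <- iota 0 n]) nzP.
  rewrite size_map size_iota ltnNge sizeP; apply.
    apply/allP => _ /mapP[i _ ->]; rewrite /root -(g_hat0 (w ^+ i)).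
      by rewrite horner_sum; apply/eqP/eq_bigr => u _; rewrite hornerZ hornerXn.
    by rewrite exprAC (prim_expr_order w_prim) expr1n.
  rewrite map_inj_in_uniq ?iota_uniq // => i j.
  rewrite !mem_iota /= => i_lt j_lt /eqP.
  by rewrite (eq_prim_root_expr w_prim) !modn_small // => /eqP.
have : P`_v = 0 by rewrite P0 coef0.
rewrite coef_sum (bigD1 v) //= coefZ coefXn eqxx mulr1 big1 ?addr0 // => u u_v.
by rewrite coefZ coefXn (inj_eq val_inj) eq_sym (negbTE u_v) mulr0.
Qed.

(* Otherwise the labelling, having no Fourier coefficient outside p Z_n, would
   be periodic of period n / p. *)
Lemma distance_magic_root n (S : {set 'Z_n}) p :
    (1 < n)%N -> prime p -> (p %| n)%N -> (forall s, s \in S -> - s \in S) ->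
    distance_magic (circ S) ->
  exists z : algC, [/\ z ^+ n = 1, z ^+ (n %/ p) != 1
    & \sum_(s in S) z ^+ (s : nat) = 0].
Proof.
move=> n_gt1 p_pr p_n symS [l [kappa [l_inj _ _ l_sum]]].
have n_gt0 := ltnW n_gt1; have p_gt0 := prime_gt0 p_pr.
have [w w_prim] := C_prim_root_exists n_gt0.
have [/existsP[k /andP[wk /eqP wk0]] | no_root] := boolP [exists k : 'I_n,
    ((w ^+ k) ^+ (n %/ p) != 1) && (\sum_(s in S) (w ^+ k) ^+ (s : nat) == 0)].
  by exists (w ^+ k); split; rewrite // exprAC (prim_expr_order w_prim) expr1n.
pose fhat (z : algC) := \sum_(v : 'Z_n) (l v)%:R * z ^+ (v : nat).
have chi_sum0 (z : algC) : z ^+ n = 1 -> z != 1 ->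
    \sum_(v : 'Z_n) z ^+ (v : nat) = 0.
  move=> zn1 z1; apply/(mulfI (_ : z - 1 != 0)); first by rewrite subr_eq0.
  rewrite mulr0 mulrBl mul1r; apply/eqP; rewrite subr_eq0; apply/eqP.
  rewrite [RHS](reindex (fun v : 'Z_n => 1 + v)); last first.
    by exists (fun v => - 1 + v) => v _; rewrite addrA ?addNr ?subrr add0r.
  rewrite mulr_sumr; apply: eq_bigr => v _.
  by rewrite expr_Zp_add // [X in z ^+ X]/= modn_small ?expr1 // ltnS Zp_cast.
have fhat0 (z : algC) : z ^+ n = 1 -> z ^+ (n %/ p) != 1 -> fhat z = 0.
  move=> zn1 zp1; have z1 : z != 1 by apply: contraNneq zp1 => ->; rewrite expr1n.
  have [k zE] := prim_rootP w_prim zn1.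
  move: no_root; rewrite negb_exists => /forallP/(_ k).
  rewrite -zE zp1 /= => nz_sum; apply/(mulfI nz_sum); rewrite mulr0.
  rewrite mulr_suml.
  (* The character sum over S times [fhat z] is the transform of the convolution of l with S. That
     convolution is constantly kappa because S = -S, and a nontrivial character sums to 0. *)
  transitivity (\sum_(s in S) \sum_(v : 'Z_n) (l (v - s))%:R * z ^+ (v : nat)).
    apply: eq_bigr => s _; rewrite mulr_sumr [RHS](reindex (fun v : 'Z_n => v + s)).
      by apply: eq_bigr => v _; rewrite addrK expr_Zp_add // mulrCA [X in _ * X]mulrC.
    by exists (fun v => v - s) => v _; rewrite ?addrK ?subrK.
  transitivity (kappa%:R * \sum_(v : 'Z_n) z ^+ (v : nat)); last first.
    by rewrite chi_sum0 ?mulr0.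
  rewrite exchange_big /= mulr_sumr.
  apply: eq_bigr => v _; rewrite -mulr_suml -(l_sum v) sum_neighbors.
  rewrite (reindex_inj oppr_inj) /= -natr_sum; congr (_%:R * _).
  apply: eq_big => [s|s _]; last by rewrite opprK.
  by apply/idP/idP => /symS; rewrite ?opprK.
pose t : 'Z_n := (n %/ p)%:R.
have tE : (t : nat) = (n %/ p)%N.
  by rewrite /t val_Zp_nat // modn_small // ltn_Pdiv // prime_gt1.
(* Subtracting l from its translate by n/p multiplies the transform by z^(n/p) - 1, which is 0
   wherever [fhat] may be nonzero. So l would be invariant under this translation, against
   injectivity. *)
have /(_ 0)/eqP : forall v, (l (v - t))%:R - (l v)%:R = 0 :> algC.
  apply: fourier_eq0 => // z zn1.
  have shift : z ^+ (n %/ p) * fhat z = \sum_v (l (v - t))%:R * z ^+ (v : nat).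
    rewrite mulr_sumr [RHS](reindex (fun v : 'Z_n => v + t)).
      apply: eq_bigr => v _.
      by rewrite addrK expr_Zp_add // tE mulrCA [X in _ * X]mulrC.
    by exists (fun v => v - t) => v _; rewrite ?addrK ?subrK.
  transitivity ((z ^+ (n %/ p) - 1) * fhat z).
    by rewrite mulrBl mul1r shift -sumrB; apply: eq_bigr => v _; rewrite mulrBl.
  have [->|zp1] := eqVneq (z ^+ (n %/ p)) 1; first by rewrite subrr mul0r.
  by rewrite (fhat0 z) // mulr0.
rewrite subr_eq0 eqr_nat => /eqP/l_inj/eqP; rewrite sub0r oppr_eq0 => /eqP t0.
by have := divn_gt0 n p_gt0; rewrite -tE t0 (dvdn_leq n_gt0 p_n).
Qed.

Lemma root_of_unity_neq0 (R : nzRingType) n (x : R) : (0 < n)%N -> x ^+ n = 1 -> x != 0.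
Proof.
by move=> n_gt0; apply: contra_eq_neq => ->; rewrite expr0n gtn_eqF // eq_sym oner_eq0.
Qed.

Lemma addV_eq (F : fieldType) (x y : F) :
  x != 0 -> y != 0 -> x + x^-1 = y + y^-1 -> x = y \/ x = y^-1.
Proof.
move=> nz_x nz_y E; have /eqP : (x - y) * (x - y^-1) = 0.
  have -> : (x - y) * (x - y^-1) = x * ((x + x^-1) - (y + y^-1)) by field; apply/andP.
  by rewrite E subrr mulr0.
by rewrite mulf_eq0 !subr_eq0 => /orP[] /eqP; [left | right].
Qed.

(* With u, v, t the sums x + 1/x, y + 1/y, w + 1/w, the Galois automorphism
   z |-> z^3 turns u + v + t = 0 into u^3 + v^3 + t^3 = 0, that is, 3uvt = 0. *)
Lemma vanishing_cosines_3 n (x y w : algC) :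
    (0 < n)%N -> coprime 3 n -> x ^+ n = 1 -> y ^+ n = 1 -> w ^+ n = 1 ->
    (x + x^-1) + (y + y^-1) + (w + w^-1) = 0 ->
  [\/ x + x^-1 = 0, y + y^-1 = 0 | w + w^-1 = 0].
Proof.
move=> n_gt0 co3 xn yn wn E; have [sigma sigmaE] := Qn_aut_exists co3.
have cube (a : algC) : a ^+ n = 1 ->
    sigma (a + a^-1) = (a + a^-1) ^+ 3 - 3 * (a + a^-1).
  move=> an; rewrite rmorphD fmorphV /= sigmaE //; field.
  exact: root_of_unity_neq0 an.
have := congr1 sigma E; rewrite rmorph0 rmorphD [X in X + _]rmorphD !cube //.
move: E; set u := x + _; set v := y + _; set t := w + _ => E E3.
have /eqP : 3 * (u * v * t) = 0.
  rewrite -E3 (_ : t = - (u + v)); first by ring.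
  by apply/eqP; rewrite -addr_eq0 addrC E.
rewrite !mulf_eq0 pnatr_eq0 /= -orbA => /or3P[] /eqP.
- by constructor 1.
- by constructor 2.
- by constructor 3.
Qed.

Lemma addV_eq0 (F : fieldType) (x : F) : x != 0 -> x + x^-1 = 0 -> x ^+ 2 = - 1.
Proof.
move=> nz_x E; apply/eqP; rewrite -subr_eq0 opprK.
have -> : x ^+ 2 + 1 = x * (x + x^-1) by field.
by rewrite E mulr0.
Qed.

Lemma addV_opp (F : fieldType) (y w : F) : y != 0 -> w != 0 ->
  (y + y^-1) + (w + w^-1) = 0 -> y * w = - 1 \/ y / w = - 1.
Proof.
move=> nz_y nz_w /eqP; rewrite addr_eq0 opprD -invrN => /eqP/addV_eq.
case=> // [|->|->]; first by rewrite oppr_eq0.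
  by right; rewrite mulNr divff.
by left; rewrite invrN mulNr mulVf.
Qed.

(** The degenerate case of two equal cosines: t = -2u and 6u^2 = 6 give u = 1 or u = -1. The first
    makes t = -2 and w = -1, impossible for n odd; the second makes x a primitive cube root of unity
    and t = 2. *)
Lemma double_cosine (n : nat) (x w : algC) :
    odd n -> x ^+ n = 1 -> w ^+ n = 1 ->
    (x + x^-1) + (x + x^-1) + (w + w^-1) = 0 ->
    (x + x^-1) ^+ 2 + (x + x^-1) ^+ 2 + (w + w^-1) ^+ 2 = 6 ->
  w = 1 /\ x ^+ 2 + x + 1 = 0.
Proof.
move=> odd_n xn wn; have n_gt0 := odd_gt0 odd_n.
have nz_x := root_of_unity_neq0 n_gt0 xn; have nz_w := root_of_unity_neq0 n_gt0 wn.
set u := x + _; set t := w + _ => /eqP; rewrite addrC addr_eq0 => /eqP tE E2.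
have /eqP : 6 * ((u - 1) * (u + 1)) = 0.
  have -> : 6 * ((u - 1) * (u + 1)) = u ^+ 2 + u ^+ 2 + t ^+ 2 - 6.
    by rewrite tE; ring.
  by rewrite E2 subrr.
rewrite !mulf_eq0 pnatr_eq0 /= subr_eq0 addr_eq0 => /orP[] /eqP uE.
  have /addV_eq : w + w^-1 = -1 + (-1)^-1 by rewrite -/t tE uE invrN1; ring.
  rewrite invrN1 oppr_eq0 oner_eq0 => /(_ nz_w isT) wE.
  have {}wE : w = - 1 by case: wE.
  move: wn; rewrite wE -signr_odd odd_n expr1 => /eqP.
  by rewrite -subr_eq0 -opprD oppr_eq0 (_ : 1 + 1 = 2%:R) // pnatr_eq0.
have /addV_eq : w + w^-1 = 1 + 1^-1 by rewrite -/t tE uE invr1; ring.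
rewrite invr1 oner_eq0 => /(_ nz_w isT) wE; split; first by case: wE.
have -> : x ^+ 2 + x + 1 = x * (u + 1) by rewrite /u; field.
by rewrite uE addNr mulr0.
Qed.

Definition coset_cube (F : fieldType) (x y w : F) :=
  [/\ x ^+ 3 = y ^+ 3, x ^+ 3 = w ^+ 3, x != y, x != w & y != w].

(* The automorphism z |-> z^2 gives u^2 + v^2 + t^2 = 6, hence uv + vt + tu = -3,
   so that u, v, t are the roots of a polynomial X^3 - 3X - e; and u^3 - 3u is
   x^3 + x^-3. *)
Lemma vanishing_cosines_odd n (x y w : algC) :
    odd n -> x ^+ n = 1 -> y ^+ n = 1 -> w ^+ n = 1 ->
    (x + x^-1) + (y + y^-1) + (w + w^-1) = 0 ->
  exists y' w', [/\ y' = y \/ y' = y^-1, w' = w \/ w' = w^-1 & coset_cube x y' w'].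
Proof.
move=> odd_n xn yn wn E; have n_gt0 := odd_gt0 odd_n.
have nz_x := root_of_unity_neq0 n_gt0 xn; have nz_w := root_of_unity_neq0 n_gt0 wn.
have nz_y := root_of_unity_neq0 n_gt0 yn.
have [|sigma sigmaE] := @Qn_aut_exists 2 n; first by rewrite coprime2n.
have square (a : algC) : a ^+ n = 1 -> sigma (a + a^-1) = (a + a^-1) ^+ 2 - 2.
  move=> an; rewrite rmorphD fmorphV /= sigmaE //; field.
  exact: root_of_unity_neq0 an.
have E2 : (x + x^-1) ^+ 2 + (y + y^-1) ^+ 2 + (w + w^-1) ^+ 2 = 6.
  have := congr1 sigma E; rewrite rmorph0 rmorphD [X in X + _]rmorphD !square //.
  by move/eqP; rewrite -subr_eq0 => /eqP E2; apply/eqP; rewrite -subr_eq0 -E2; apply/eqP; ring.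
have cube_eq (u v t : algC) : u + v + t = 0 -> u ^+ 2 + v ^+ 2 + t ^+ 2 = 6 ->
    u ^+ 3 - 3 * u = v ^+ 3 - 3 * v.
  move=> /eqP; rewrite addrC addr_eq0 => /eqP -> e2.
  apply/eqP; rewrite -subr_eq0; have /eqP : 2 * ((u ^+ 3 - 3 * u) - (v ^+ 3 - 3 * v)) = 0.
    rewrite (_ : 2 * _ = (u - v) * (u ^+ 2 + v ^+ 2 + (- (u + v)) ^+ 2 - 6)); last by ring.
    by rewrite e2 subrr mulr0.
  by rewrite mulf_eq0 pnatr_eq0.
have cubeV (a : algC) : a != 0 -> (a + a^-1) ^+ 3 - 3 * (a + a^-1) = a ^+ 3 + (a ^+ 3)^-1.
  by move=> nz_a; field.
have cube_root (a b : algC) : a != 0 -> b != 0 ->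
    (a + a^-1) ^+ 3 - 3 * (a + a^-1) = (b + b^-1) ^+ 3 - 3 * (b + b^-1) ->
    exists2 b', b' = b \/ b' = b^-1 & a ^+ 3 = b' ^+ 3.
  move=> nz_a nz_b; rewrite !cubeV // => /addV_eq; rewrite !expf_neq0 // => -[] // e.
    by exists b; [left | ].
  by exists b^-1; [right | rewrite e exprVn].
have [y1 y1E xy1] : exists2 y', y' = y \/ y' = y^-1 & x ^+ 3 = y' ^+ 3.
  by apply: cube_root => //; apply: cube_eq E E2.
have [w1 w1E xw1] : exists2 w', w' = w \/ w' = w^-1 & x ^+ 3 = w' ^+ 3.
  by apply: cube_root => //; apply: cube_eq (y + y^-1) _ _; rewrite addrAC.
have yE : y + y^-1 = y1 + y1^-1 by case: y1E => ->; rewrite ?invrK // addrC.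
have wE : w + w^-1 = w1 + w1^-1 by case: w1E => ->; rewrite ?invrK // addrC.
have y1n : y1 ^+ n = 1 by case: y1E => ->; rewrite // exprVn yn invr1.
have w1n : w1 ^+ n = 1 by case: w1E => ->; rewrite // exprVn wn invr1.
have y1V : y1^-1 = y \/ y1^-1 = y^-1 by case: y1E => ->; rewrite ?invrK; auto.
have w1V : w1^-1 = w \/ w1^-1 = w^-1 by case: w1E => ->; rewrite ?invrK; auto.
have cube_root1 (a : algC) : a ^+ 2 + a + 1 = 0 ->
    [/\ a ^+ 3 = 1, a != 1, a^-1 != 1 & a != a^-1].
  move=> a0; have a3 : a ^+ 3 = 1.
    by apply/eqP; rewrite -subr_eq0 -(mulr0 (a - 1)) -a0; apply/eqP; ring.
  have a1 : a != 1.
    apply/eqP => a1; move/eqP: a0; rewrite a1 expr1n.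
    by rewrite (_ : 1 + 1 + 1 = 3%:R) ?pnatr_eq0 //; ring.
  split=> //; first by rewrite invr_eq1.
  have nz_a : a != 0 by apply: root_of_unity_neq0 a3.
  apply: contraNneq a1 => aV; rewrite -a3 exprS expr2 {3}aV mulVf //.
  by rewrite mulr1.
move: E E2; rewrite yE wE => E E2.
(* Equal cubes do not make the three elements distinct. If two coincide, [double_cosine] says that
   they are a primitive cube root of unity and that the third is 1; inverting one of the two gives
   the whole group of cube roots. *)
have [xy|x_y] := eqVneq x y1.
  move: E E2; rewrite -xy => E E2.
  case: (@double_cosine n x w1) => // w11 /cube_root1[x3 x1 xV xxV].
  exists y1^-1, w1; split=> //; rewrite w11 -xy; split; rewrite ?exprVn ?x3 ?invr1 ?expr1n //.
have [xw|x_w] := eqVneq x w1.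
  move: E E2; rewrite -xw addrAC [in X in _ -> X]addrAC => E E2.
  case: (@double_cosine n x y1) => // y11 /cube_root1[x3 x1 xV xxV].
  exists y1, w1^-1; split=> //; rewrite y11 -xw; split; rewrite ?exprVn ?x3 ?invr1 ?expr1n //.
  by rewrite eq_sym.
have [yw|y_w] := eqVneq y1 w1; last by exists y1, w1.
move: E E2; rewrite -yw -addrA addrC -[in X in _ -> X]addrA [in X in _ -> X]addrC => E E2.
case: (@double_cosine n y1 x) => // x1 /cube_root1[y3 y1' yV yyV].
exists y1, w1^-1; split=> //; rewrite x1 -yw; split; rewrite ?exprVn ?y3 ?invr1 ?expr1n //.
  by rewrite eq_sym.
by rewrite eq_sym.
Qed.

Lemma prim_order_dvdz (F : fieldType) N (z : F) (i : int) :
  N.-primitive_root z -> (z ^ i == 1) = (N%:Z %| i)%Z.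
Proof.
move=> z_prim; case: i => k; first by rewrite -exprnP -(prim_order_dvd z_prim).
by rewrite NegzE -exprnN invr_eq1 -(prim_order_dvd z_prim) dvdz_oppr.
Qed.

Lemma expr_intr_Zp (F : fieldType) n (z : F) (i : int) :
  (1 < n)%N -> z ^+ n = 1 -> z ^+ (i%:~R : 'Z_n) = z ^ i.
Proof.
move=> n_gt1 zn1; have nz_z := root_of_unity_neq0 (ltnW n_gt1) zn1.
have /dvdzP[k iE] : (n%:Z %| i - (i%:~R : 'Z_n)%:Z)%Z.
  by rewrite -eq_intr_Zp // Zp_intr.
rewrite -[i in RHS](subrK (i%:~R : 'Z_n)%:Z) iE expfzDr //.
by rewrite [k * _]mulrC -exprz_exp -exprnP zn1 exp1rz mul1r.
Qed.

(** If p divided the cofactor n/N, then N would divide n/p; so N carries the full power of p. *)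
Lemma part_dvd_of_ndvd_div (n N p : nat) :
    prime p -> (0 < n)%N -> (p %| n)%N -> (N %| n)%N -> ~~ (N %| n %/ p)%N ->
  (n`_p %| N)%N.
Proof.
move=> p_pr n_gt0 p_n /dvdnP[k nE] N_np; have p_k : ~~ (p %| k)%N.
  apply: contra N_np => /dvdnP[k' kE].
  by rewrite nE kE mulnAC mulnK ?prime_gt0 // dvdn_mull.
rewrite -(@Gauss_dvdr _ k); first by rewrite -nE dvdn_part.
by rewrite p_part coprimeXl // prime_coprime.
Qed.

(* For z of order N: z^A = i or -i, and z^B z^C = -1. *)
Definition quarter (N : nat) (A B C : int) :=
  [/\ (N%:Z %| 4 * A)%Z, ~~ (N%:Z %| 2 * A)%Z,
      (N%:Z %| 2 * (B + C))%Z & ~~ (N%:Z %| B + C)%Z].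

(* For z of order N: z^A, z^B, z^C are distinct and have the same cube. *)
Definition thirds (N : nat) (A B C : int) :=
  [/\ (N%:Z %| 3 * (A - B))%Z, (N%:Z %| 3 * (A - C))%Z, ~~ (N%:Z %| A - B)%Z,
      ~~ (N%:Z %| A - C)%Z & ~~ (N%:Z %| B - C)%Z].

Lemma pm3_oppr n (a b c s : 'Z_n) : s \in pm3 a b c -> - s \in pm3 a b c.
Proof.
rewrite !inE -!orbA => /or4P[|||/or3P[||]] /eqP->; by rewrite ?opprK eqxx ?orbT.
Qed.

Lemma distance_magic_pm3_root n (A B C : int) p :
    (1 < n)%N -> #|pm3 (A%:~R : 'Z_n) B%:~R C%:~R| = 6%N ->
    distance_magic (circ (pm3 (A%:~R : 'Z_n) B%:~R C%:~R)) ->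
    prime p -> (p %| n)%N ->
  exists (z : algC) (N : nat),
    [/\ N.-primitive_root z, z ^+ n = 1, (N %| n)%N, (n`_p %| N)%N
      & (z ^ A + (z ^ A)^-1) + (z ^ B + (z ^ B)^-1) + (z ^ C + (z ^ C)^-1) = 0].
Proof.
move=> n_gt1 card6 dm p_pr p_n; have n_gt0 := ltnW n_gt1.
have [z [zn1 znp z_sum]] := distance_magic_root n_gt1 p_pr p_n (@pm3_oppr _ _ _ _) dm.
have [N z_prim N_n] := prim_order_exists n_gt0 zn1; exists z, N; split=> //.
  by apply: part_dvd_of_ndvd_div; rewrite // (prim_order_dvd z_prim).
move: z_sum; rewrite sum_pm3 // => <-.
by rewrite -!mulrNz !expr_intr_Zp // !invr_expz !addrA.
Qed.

Lemma quarter_intro (z : algC) N (A B C : int) :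
    N.-primitive_root z -> (z ^ A) ^+ 2 = - 1 -> z ^ B * z ^ C = - 1 ->
  quarter N A B C.
Proof.
move=> z_prim zA zBC; have nz_z : z != 0.
  exact: (root_of_unity_neq0 (prim_order_gt0 z_prim) (prim_expr_order z_prim)).
have N1 : (- 1 : algC) == 1 = false.
  by rewrite -subr_eq0 -opprD oppr_eq0 (_ : 1 + 1 = 2%:R) // pnatr_eq0.
have zA2 : z ^ (2 * A) = - 1 by rewrite mulrC -exprz_exp.
have zBC1 : z ^ (B + C) = - 1 by rewrite expfzDr.
split; rewrite -(prim_order_dvdz _ z_prim) ?zA2 ?zBC1 ?N1 //.
- rewrite (_ : 4 * A = 2 * A + 2 * A); last by ring.
  by rewrite expfzDr // zA2 mulrNN mulr1.
- rewrite (_ : 2 * (B + C) = (B + C) + (B + C)); last by ring.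
  by rewrite expfzDr // zBC1 mulrNN mulr1.
Qed.

Lemma distance_magic_quarter n (A B C : int) p :
    (1 < n)%N -> ~~ (3 %| n)%N -> #|pm3 (A%:~R : 'Z_n) B%:~R C%:~R| = 6%N ->
    distance_magic (circ (pm3 (A%:~R : 'Z_n) B%:~R C%:~R)) ->
    prime p -> (p %| n)%N ->
  exists N : nat, [/\ (N %| n)%N, (n`_p %| N)%N
    & [\/ quarter N A B C \/ quarter N A B (- C),
          quarter N B A C \/ quarter N B A (- C)
        | quarter N C A B \/ quarter N C A (- B)]].
Proof.
move=> n_gt1 n3 card6 dm p_pr p_n; have n_gt0 := ltnW n_gt1.
have [z [N [z_prim zn1 N_n p_N E]]] := distance_magic_pm3_root n_gt1 card6 dm p_pr p_n.
have nz_z := root_of_unity_neq0 n_gt0 zn1.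
have nz i : z ^ i != 0 by rewrite expfz_neq0.
have zin i : (z ^ i) ^+ n = 1 by rewrite exprnP exprzAC -exprnP zn1 exp1rz.
have case_quarter X Y Z : z ^ X + (z ^ X)^-1 = 0 ->
    (z ^ Y + (z ^ Y)^-1) + (z ^ Z + (z ^ Z)^-1) = 0 ->
    quarter N X Y Z \/ quarter N X Y (- Z).
  move=> /(addV_eq0 (nz X)) zX /(addV_opp (nz Y) (nz Z))[] zYZ; [left | right].
    exact: quarter_intro zX zYZ.
  by apply: quarter_intro zX _; rewrite // -invr_expz.
exists N; split=> //.
have co3 : coprime 3 n by rewrite prime_coprime.
have [u0|v0|t0] := vanishing_cosines_3 n_gt0 co3 (zin A) (zin B) (zin C) E.
- by constructor 1; apply: case_quarter => //; move: E; rewrite u0 add0r.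
- by constructor 2; apply: case_quarter => //; move: E; rewrite v0 addr0.
- by constructor 3; apply: case_quarter => //; move: E; rewrite t0 addr0.
Qed.

Lemma thirds_intro (z : algC) N (A B C : int) :
    N.-primitive_root z -> coset_cube (z ^ A) (z ^ B) (z ^ C) -> thirds N A B C.
Proof.
move=> z_prim [AB3 AC3 AB AC BC]; have nz_z : z != 0.
  exact: (root_of_unity_neq0 (prim_order_gt0 z_prim) (prim_expr_order z_prim)).
have zD X Y : (z ^ (X - Y) == 1) = (z ^ X == z ^ Y).
  have nz_zY := expfz_neq0 Y nz_z.
  by rewrite expfzDr // -invr_expz -[RHS](inj_eq (mulIf (invr_neq0 nz_zY))) divff.
have z3D X Y : (z ^ X) ^+ 3 = (z ^ Y) ^+ 3 -> z ^ (3 * (X - Y)) == 1.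
  move=> E; rewrite mulrBr zD ![3 * _]mulrC -!exprz_exp.
  by apply/eqP.
by split; rewrite -(prim_order_dvdz _ z_prim) ?zD // z3D.
Qed.

Lemma distance_magic_thirds n (A B C : int) p :
    (1 < n)%N -> odd n -> #|pm3 (A%:~R : 'Z_n) B%:~R C%:~R| = 6%N ->
    distance_magic (circ (pm3 (A%:~R : 'Z_n) B%:~R C%:~R)) ->
    prime p -> (p %| n)%N ->
  exists (N : nat) (B' C' : int), [/\ (N %| n)%N, (n`_p %| N)%N,
    B' = B \/ B' = - B, C' = C \/ C' = - C & thirds N A B' C'].
Proof.
move=> n_gt1 odd_n card6 dm p_pr p_n; have n_gt0 := ltnW n_gt1.
have [z [N [z_prim zn1 N_n p_N E]]] := distance_magic_pm3_root n_gt1 card6 dm p_pr p_n.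
have zin i : (z ^ i) ^+ n = 1 by rewrite exprnP exprzAC -exprnP zn1 exp1rz.
have [y [w [yE wE yw]]] :=
  vanishing_cosines_odd odd_n (zin A) (zin B) (zin C) E.
have lift (X : int) (a : algC) : a = z ^ X \/ a = (z ^ X)^-1 ->
    exists2 X', X' = X \/ X' = - X & a = z ^ X'.
  case=> ->; first by exists X; [left|].
  by exists (- X); [right | rewrite invr_expz].
have [B' B'E yB'] := lift _ _ yE; have [C' C'E wC'] := lift _ _ wE.
exists N, B', C'; split=> //; apply: thirds_intro z_prim _.
by rewrite -yB' -wC'.
Qed.

(* If n = 2 (mod 4), then kappa and the sum of all labels are odd, whereas the sum
   over v of l(v) times the sum of the labels around v counts each edge twice. *)
Lemma distance_magic_pm3_mod4 n (A B C : int) :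
    (1 < n)%N -> #|pm3 (A%:~R : 'Z_n) B%:~R C%:~R| = 6%N ->
    distance_magic (circ (pm3 (A%:~R : 'Z_n) B%:~R C%:~R)) ->
  odd n \/ (4 %| n)%N.
Proof.
move=> n_gt1 card6 [l [kappa [l_inj l_im _ l_sum]]].
have cardZ : #|'Z_n| = n by rewrite card_ord Zp_cast.
have sum_l : ((\sum_v l v) * 2 = n * (n + 1))%N.
  have l_perm : perm_eq [seq l v | v : 'Z_n] (iota 1 n).
    apply: uniq_perm; [by rewrite map_inj_uniq ?enum_uniq | exact: iota_uniq | move=> k].
    rewrite mem_iota add1n ltnS; apply/mapP/idP => [[v _ ->]|k_n].
      by have := (l_im (l v)).2 (ex_intro _ v erefl); rewrite cardZ.
    have [|v <-] := (l_im k).1; first by rewrite cardZ.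
    by exists v; rewrite ?mem_enum.
  have -> : (\sum_v l v = \sum_(k <- iota 1 n) k)%N.
    by rewrite -(perm_big _ l_perm) big_map big_enum.
  have := bin2_sum n.+1; rewrite bin2 big_ltn // add0n /index_iota subn1 /= => ->.
  by rewrite -divn2 divnK ?dvdn2 ?oddM /= ?andNb // addn1 mulnC.
pose nbr_sum (v : 'Z_n) := (l (v + A%:~R)%R + l (v - A%:~R)%R + l (v + B%:~R)%R
  + l (v - B%:~R)%R + l (v + C%:~R)%R + l (v - C%:~R)%R)%N.
have sumE v : nbr_sum v = kappa by rewrite -[RHS](l_sum v) sum_neighbors sumn_pm3.
have shift (F : 'Z_n -> nat) s : (\sum_v F (v + s)%R = \sum_v F v)%N.
  rewrite [RHS](reindex (fun v : 'Z_n => v + s)) //.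
  by exists (fun v => v - s) => v _; rewrite ?addrK ?subrK.
have kappa_sum : (n * kappa = 6 * \sum_v l v)%N.
  transitivity (\sum_v nbr_sum v)%N.
    by rewrite (eq_bigr _ (fun v _ => sumE v)) sum_nat_const cardZ.
  rewrite !big_split /= !(shift l); by move: (\sum_v _)%N => X; lia.
have kappaE : kappa = (3 * (n + 1))%N by nia.
have shiftN (s : 'Z_n) : (\sum_v l v * l (v - s)%R = \sum_v l v * l (v + s)%R)%N.
  rewrite -[LHS](shift _ s); apply: eq_bigr => v _; by rewrite addrK mulnC.
have double : (kappa * \sum_v l v = 2 * (\sum_v l v * l (v + A%:~R)%R
    + \sum_v l v * l (v + B%:~R)%R + \sum_v l v * l (v + C%:~R)%R))%N.
  transitivity (\sum_v l v * nbr_sum v)%N.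
    by rewrite mulnC big_distrl; apply: eq_bigr => v _; rewrite sumE.
  under eq_bigr => v _ do rewrite !mulnDr.
  rewrite !big_split /= !shiftN; move: (\sum_v _ * l (_ + A%:~R)%R)%N => a.
  move: (\sum_v _ * l (_ + B%:~R)%R)%N (\sum_v _ * l (_ + C%:~R)%R)%N => b c.
  by lia.
case: (boolP (odd n)) => [|even_n]; [by left | right].
move: double; rewrite kappaE; set X := (\sum_v _)%N in sum_l *.
set Y := (_ + _ + _)%N => double.
(* For n even, kappa = 3(n + 1) is odd, so the sum X of all labels is even; then 2X = n(n + 1)
   forces 4 to divide n. *)
have even_X : ~~ odd X.
  have : ~~ odd (3 * (n + 1) * X) by rewrite double oddM.
  by rewrite !oddM oddD (negbTE even_n).
by move: sum_l even_n even_X; move: {double Y} X => X; nia.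
Qed.

(** * Arithmetic in Z_n *)

Lemma dvdz_part (m : nat) (x : int) : (0 < m)%N ->
  (forall p, prime p -> (p %| m)%N -> ((m`_p)%N%:Z %| x)%Z) -> (m%:Z %| x)%Z.
Proof.
move=> m_gt0 dvd_p; rewrite dvdzE; apply/(dvdn_partP _ m_gt0) => p.
by rewrite mem_primes => /and3P[p_pr _ /(dvd_p p p_pr)].
Qed.

Lemma coprimez_prime (m : nat) (x : int) : (0 < m)%N ->
  (forall p, prime p -> (p %| m)%N -> ~~ (p%:Z %| x)%Z) -> coprimez m%:Z x.
Proof.
move=> m_gt0 ndvd; rewrite coprimezE /=; apply: contraT => nco.
have gcd_neq1 : gcdn m `|x| != 1%N by [].
have /pdivP[p p_pr p_g] : (1 < gcdn m `|x|)%N.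
  by rewrite ltn_neqAle eq_sym gcd_neq1 gcdn_gt0 m_gt0.
have /negP[] := ndvd p p_pr (dvdn_trans p_g (dvdn_gcdl _ _)).
by rewrite dvdzE /= (dvdn_trans p_g (dvdn_gcdr _ _)).
Qed.

(** Multiplication by p changes only the p-adic valuation, so x falls short of divisibility by N at
    p alone, and by exactly one factor p. *)
Lemma logn_dvd_succ (p N : nat) (x : int) : prime p -> (0 < N)%N ->
    (N%:Z %| p%:Z * x)%Z -> ~~ (N%:Z %| x)%Z ->
  (0 < `|x|)%N /\ logn p N = (logn p `|x|).+1.
Proof.
move=> p_pr N_gt0; rewrite !dvdzE abszM !absz_nat => N_px N_x.
have x_gt0 : (0 < `|x|)%N by case: (`|x|)%N N_x; rewrite ?dvdn0.
split=> //; apply/eqP; rewrite eqn_leq; apply/andP; split.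
  have px_gt0 : (0 < p * `|x|)%N by rewrite muln_gt0 prime_gt0.
  have := dvdn_leq_log p px_gt0 N_px.
  rewrite lognM //; last exact: prime_gt0.
  by rewrite (logn_prime p p_pr) eqxx.
rewrite ltnNge; apply: contra N_x => le_log.
rewrite -(partnC p N_gt0) Gauss_dvd ?coprime_partC //; apply/andP; split.
  by rewrite p_part pfactor_dvdn.
have co_p : coprime (N`_p^')%N p.
  by rewrite coprime_sym prime_coprime // -p'natE // part_pnat.
by rewrite -(Gauss_dvdr _ co_p) (dvdn_trans (dvdn_part _ _)).
Qed.

Lemma eq_logn_part (p n N : nat) : prime p -> (0 < n)%N -> (N %| n)%N ->
  (n`_p %| N)%N -> logn p N = logn p n.
Proof.
move=> p_pr n_gt0 N_n n_N; have N_gt0 := dvdn_gt0 n_gt0 N_n.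
apply/eqP; rewrite eqn_leq dvdn_leq_log //=.
by rewrite -(pfactor_dvdn _ p_pr N_gt0) -p_part.
Qed.

(** This is [logn_dvd_succ] at the prime 2, for 2A and for B + C. In particular 4 divides N, which
    is what makes n divisible by 4. *)
Lemma quarter_logn N A B C : (0 < N)%N -> quarter N A B C ->
  [/\ logn 2 N = (logn 2 `|A|).+2, logn 2 N = (logn 2 `|(B + C)%R|).+1,
      (0 < `|A|)%N & (0 < `|(B + C)%R|)%N].
Proof.
move=> N_gt0 [N4A N2A N2BC NBC].
have [A2_gt0 E] : (0 < `|(2 * A)%R|)%N /\ logn 2 N = (logn 2 `|(2 * A)%R|).+1.
  by apply: logn_dvd_succ => //; rewrite mulrA.
have [BC_gt0 E'] : (0 < `|(B + C)%R|)%N /\ logn 2 N = (logn 2 `|(B + C)%R|).+1.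
  exact: logn_dvd_succ.
have A_gt0 : (0 < `|A|)%N by rewrite abszM muln_gt0 in A2_gt0; case/andP: A2_gt0.
by split; rewrite // E abszM lognM // (logn_prime 2 (isT : prime 2)).
Qed.

Lemma odd_part_dvd p (n N : nat) (k : int) (x : int) : prime p -> (0 < n)%N ->
    coprimez p%:Z k -> (n`_p %| N)%N -> (N%:Z %| k * x)%Z -> ((n`_p)%N%:Z %| x)%Z.
Proof.
move=> p_pr n_gt0 co_pk n_N /(dvdz_trans (_ : ((n`_p)%N%:Z %| N%:Z)%Z)) dvd.
rewrite -(@Gauss_dvdzr _ k) ?dvd ?dvdzE //.
by rewrite coprimezE absz_nat p_part coprimeXl.
Qed.

Lemma logn2_parity (x : int) : (0 < `|x|)%N ->
  [/\ (logn 2 `|x| == 0%N) = ~~ (2 %| x)%Z, (0 < logn 2 `|x|)%N = (2 %| x)%Z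
    & (1 < logn 2 `|x|)%N = (4 %| x)%Z].
Proof.
move=> x_gt0; have E : (0 < logn 2 `|x|)%N = (2 %| x)%Z.
  by rewrite -(pfactor_dvdn 1) // dvdzE.
by rewrite -E -(pfactor_dvdn 2) // dvdzE -leqNgt leqn0.
Qed.

Lemma unit_multiple_int n (q A B C A' B' C' : int) : (1 < n)%N -> coprimez n%:Z q ->
    (n%:Z %| q * A - A')%Z \/ (n%:Z %| q * A + A')%Z ->
    (n%:Z %| q * B - B')%Z \/ (n%:Z %| q * B + B')%Z ->
    (n%:Z %| q * C - C')%Z \/ (n%:Z %| q * C + C')%Z ->
  unit_multiple (pm3 (A%:~R : 'Z_n) B%:~R C%:~R) (pm3 A'%:~R B'%:~R C'%:~R).
Proof.
move=> n_gt1 co_q hA hB hC; exists q%:~R; first by rewrite unit_intr_Zp.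
have conv X X' : (n%:Z %| q * X - X')%Z \/ (n%:Z %| q * X + X')%Z ->
    q%:~R * X%:~R = X'%:~R :> 'Z_n \/ q%:~R * X%:~R = - X'%:~R :> 'Z_n.
  rewrite -intrM -mulrNz; case=> dvd; [left | right]; apply/eqP; rewrite eq_intr_Zp //.
  by rewrite opprK.
by rewrite imset_pm3; apply: pm3_eqN; apply: conv.
Qed.

Lemma unit_multiple_trans n (S T U : {set 'Z_n}) :
  unit_multiple S T -> unit_multiple T U -> unit_multiple S U.
Proof.
move=> [q uq <-] [q' uq' <-]; exists (q' * q); first by rewrite unitrM uq uq'.
by rewrite -imset_comp; apply: eq_imset => s /=; rewrite mulrA.
Qed.

Lemma inverse_modz (n : nat) (x : int) : coprimez n%:Z x ->
  exists2 q : int, coprimez n%:Z q & (n%:Z %| q * x - 1)%Z.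
Proof.
move=> co; have [u [v E]] := Bezoutz n%:Z x.
have {}E : u * n%:Z + v * x = 1.
  by rewrite E; apply/eqP; move: co; rewrite coprimezE /coprime /gcdz /= => /eqP->.
exists v; last by rewrite -E opprD addrCA subrr addr0 dvdzE abszN -dvdzE dvdz_mull.
apply/coprimezP; exists (u, x) => /=; by rewrite -E mulrC [x * v]mulrC mulrC.
Qed.

(** The residues divisible by p form a proper subgroup, which would contain S. *)
Lemma generate_pm3 n (A B C : int) p : (1 < n)%N -> (1 < p)%N -> (p %| n)%N ->
    <<pm3 (A%:~R : 'Z_n) B%:~R C%:~R>>%g = [set: 'Z_n] ->
  (p%:Z %| A)%Z -> (p%:Z %| B)%Z -> (p%:Z %| C)%Z -> False.
Proof.
move=> n_gt1 p_gt1 p_n gen pA pB pC.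
pose H : {set 'Z_n} := [set x : 'Z_n | (p %| x)%N].
have HE (i : int) : (i%:~R \in H) = (p%:Z %| i)%Z.
  rewrite inE; have /dvdzP[k iE] : (n%:Z %| i - (i%:~R : 'Z_n)%:Z)%Z.
    by rewrite -eq_intr_Zp // Zp_intr.
  rewrite -[in RHS](subrK (i%:~R : 'Z_n)%:Z i) iE rpredDl ?dvdzE //.
  by rewrite abszM dvdn_mull.
have group_H : group_set H.
  apply/group_setP; split; first by rewrite inE dvdn0.
  move=> x y xH yH; rewrite -[x]Zp_intr -[y]Zp_intr -[(_ * _)%g]/(_ + _) -intrD HE.
  by rewrite rpredD // -HE Zp_intr.
have sub_H : pm3 (A%:~R : 'Z_n) B%:~R C%:~R \subset H.
  apply/subsetP => s; rewrite 5!in_setU 6!in_set1 -!orbA -!mulrNz.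
  by case/or4P=> [/eqP->|/eqP->|/eqP->|/or3P[]/eqP->]; rewrite HE ?dvdz_oppr.
have : <<pm3 (A%:~R : 'Z_n) B%:~R C%:~R>>%g \subset Group group_H by rewrite gen_subG.
rewrite gen => /subsetP/(_ 1%:~R); rewrite inE => /(_ isT) H1.
have : 1%:~R \in H by [].
by rewrite HE dvdzE /= dvdn1 => /eqP p1; rewrite p1 in p_gt1.
Qed.

(** * Orders not divisible by 3 *)

Definition jointly_coprime (n : nat) (A B C : int) := forall p, prime p -> (p %| n)%N ->
  ~ [/\ (p%:Z %| A)%Z, (p%:Z %| B)%Z & (p%:Z %| C)%Z].

Definition quarterly (n : nat) (A B C : int) := forall p, prime p -> (p %| n)%N ->
  exists N : nat, [/\ (N %| n)%N, (n`_p %| N)%N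
    & [\/ quarter N A B C \/ quarter N A B (- C),
          quarter N B A C \/ quarter N B A (- C)
        | quarter N C A B \/ quarter N C A (- B)]].

Lemma dvdz_dvdn (m n : nat) (x : int) : (m %| n)%N -> (n%:Z %| x)%Z -> (m%:Z %| x)%Z.
Proof. by move=> m_n; apply: dvdz_trans; rewrite dvdzE. Qed.

Lemma nat_residue (n : nat) (x : int) : (0 < n)%N ->
  exists2 y : nat, (y < n)%N & (n%:Z %| y%:Z - x)%Z.
Proof.
move=> n_gt0; exists `|(x %% n%:Z)%Z|%N; first by have := modz_bound x n_gt0; lia.
have := modz_bound x n_gt0 => /andP[mod_ge0 _].
by rewrite gez0_abs // -eqz_mod_dvd modz_mod.
Qed.

Lemma quarter_odd_part p n N A B C : prime p -> odd p -> (0 < n)%N ->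
    (n`_p %| N)%N -> quarter N A B C ->
  ((n`_p)%N%:Z %| A)%Z /\ ((n`_p)%N%:Z %| B + C)%Z.
Proof.
move=> p_pr odd_p n_gt0 n_N [N4A _ N2BC _].
have co2 : coprimez p%:Z 2 by rewrite coprimezE /= coprimen2.
have co4 : coprimez p%:Z 4 by rewrite coprimezE /= (@coprime_pexpr 2 p 2) // coprimen2.
by split; [apply: odd_part_dvd co4 n_N N4A | apply: odd_part_dvd co2 n_N N2BC].
Qed.

(** The 2-adic valuation of B + C exceeds that of A by 1 whatever N is. Hence the residues of A, B,
    C modulo 4 exclude alternatives even for the N attached to an odd prime, whose 2-part is not
    known. *)
Lemma quarter_parity N A B C : (0 < N)%N -> quarter N A B C ->
  (2 %| B + C)%Z /\ ((2 %| A)%Z = (4 %| B + C)%Z).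
Proof.
move=> N_gt0 /(quarter_logn N_gt0)[E1 E2 A_gt0 BC_gt0].
have [_ A2 _] := logn2_parity A_gt0; have [_ BC2 BC4] := logn2_parity BC_gt0.
by rewrite -BC2 -BC4 -A2; split; lia.
Qed.

Lemma logn2_mul4 n : (0 < n)%N -> logn 2 (4 * n) = (logn 2 n).+2.
Proof.
move=> n_gt0; rewrite (_ : 4 * n = 2 * (2 * n))%N; last by rewrite mulnA.
by rewrite !lognM ?muln_gt0.
Qed.

Lemma pm3_A1 n n0 : pm3 ((1 : int)%:~R : 'Z_n) n0%:Z%:~R (2 * n0%:Z - 1)%:~R =
  pm3 1 n0%:R (2 * n0%:R - 1).
Proof. by rewrite rmorphB rmorphM /= -!pmulrn. Qed.

Lemma pm3_A2 n n0 : pm3 ((2 : int)%:~R : 'Z_n) n0%:Z%:~R (2 * n0%:Z - 2)%:~R =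
  pm3 2 n0%:R (2 * n0%:R - 2).
Proof. by rewrite rmorphB rmorphM /= -!pmulrn. Qed.

Lemma coprimez_odd n (q : int) : (4 %| n)%N -> coprimez n%:Z q -> ~~ (2 %| q)%Z.
Proof.
rewrite coprimezE => n4 /eqP co; apply/negP; rewrite dvdzE /= => q2.
have : (2 %| gcdn n `|q|)%N by rewrite dvdn_gcd q2 (dvdn_trans _ n4).
by rewrite [gcdn _ _]co.
Qed.

(** A is an odd multiple of n0, and stays so when multiplied by the odd q; every odd number is 1 or
    -1 modulo 4. So q remains free to normalise another element of S. *)
Lemma odd_multiple n n0 (A q : int) : n = (4 * n0)%N -> (n0%:Z %| A)%Z ->
    ~~ ((2 * n0)%N%:Z %| A)%Z -> ~~ (2 %| q)%Z ->
  (n%:Z %| q * A - n0%:Z)%Z \/ (n%:Z %| q * A + n0%:Z)%Z.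
Proof.
move=> nE /dvdzP[u ->] nA q_odd; have u_odd : ~~ (2 %| u)%Z.
  apply: contra nA => /dvdzP[v ->]; apply/dvdzP; exists v; rewrite PoszM; ring.
have qu_odd : ~~ (2 %| q * u)%Z.
  by rewrite (@Gauss_dvdzl 2 q u) //; rewrite coprimezE /= coprime2n; lia.
have [k [kE|kE]] : exists k : int, q * u = 4 * k + 1 \/ q * u = 4 * k - 1.
  move: (q * u) qu_odd => v v_odd.
  have [v1|v3] : (v %% 4)%Z = 1 \/ (v %% 4)%Z = 3 by lia.
    by exists (v %/ 4)%Z; lia.
  by exists ((v %/ 4)%Z + 1); lia.
- left; apply/dvdzP; exists k; rewrite mulrA kE nE PoszM; ring.
- right; apply/dvdzP; exists k; rewrite mulrA kE nE PoszM; ring.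
Qed.

Lemma unit_multiple_A1 n n0 (A B C : int) : n = (4 * n0)%N -> (0 < n0)%N ->
    (n0%:Z %| A)%Z -> ~~ ((2 * n0)%N%:Z %| A)%Z ->
    ((2 * n0)%N%:Z %| B + C)%Z -> ~~ (n%:Z %| B + C)%Z -> coprimez n%:Z B ->
  unit_multiple (pm3 (A%:~R : 'Z_n) B%:~R C%:~R) (pm3 1 n0%:R (2 * n0%:R - 1)).
Proof.
move=> nE n0_gt0 n0A n0A' BC BC' co; have n_gt1 : (1 < n)%N by rewrite nE (@leq_trans 4) // leq_pmulr.
have [q co_q qB] := inverse_modz co.
have q_odd : ~~ (2 %| q)%Z by apply: coprimez_odd co_q; rewrite nE dvdn_mulr.
rewrite -pm3_A1 pm3C12; apply: (unit_multiple_int (q := q)) => //; first by left.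
  exact: odd_multiple.
left; have : (n%:Z %| q * (B + C) - (2 * n0)%N%:Z)%Z.
  (* With 2n and 2 n0 in place of n and n0, [odd_multiple] gives q(B + C) = 2 n0 or -2 n0 modulo 2n;
     modulo n the two agree. *)
  have n2E : (2 * n = 4 * (2 * n0))%N by rewrite nE mulnCA.
  have BC'' : ~~ ((2 * (2 * n0))%N%:Z %| B + C)%Z by rewrite mulnA -nE.
  have [E|E] := odd_multiple n2E BC BC'' q_odd.
    by apply: dvdz_dvdn E; rewrite dvdn_mull.
  rewrite (_ : _ - _ = q * (B + C) + (2 * n0)%N%:Z - n%:Z); last by rewrite nE; lia.
  by rewrite rpredB //; apply: dvdz_dvdn E; rewrite dvdn_mull.
rewrite (_ : _ - (2 * n0%:Z - 1) = (q * (B + C) - (2 * n0)%N%:Z) - (q * B - 1)).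
  by move=> dvd; rewrite rpredB.
by rewrite PoszM; ring.
Qed.

(** For n0 even the valuations at 2 make A even and B + C divisible by 4, so B and C are odd by
    generation, and B - C is 2 modulo 4. By [quarter_parity] every odd prime must then choose the
    same alternative as 2, and [unit_multiple_A1] applies. *)
Lemma quarterly_even n n0 (A B C : int) N : n = (4 * n0)%N -> (0 < n0)%N -> ~~ odd n0 ->
    jointly_coprime n A B C -> quarterly n A B C ->
    (N %| n)%N -> (n`_2 %| N)%N -> quarter N A B C ->
  unit_multiple (pm3 (A%:~R : 'Z_n) B%:~R C%:~R) (pm3 1 n0%:R (2 * n0%:R - 1)).
Proof.
move=> nE n0_gt0 even_n0 gen inf N_n n_N quarN.
have n_gt0 : (0 < n)%N by lia.
have p2_n : (2 %| n)%N by rewrite nE dvdn_mulr.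
have N_gt0 := dvdn_gt0 n_gt0 N_n.
have [NA NBC A_gt0 BC_gt0] := quarter_logn N_gt0 quarN.
have logN : logn 2 N = (logn 2 n0).+2.
  rewrite (eq_logn_part _ n_gt0 N_n n_N) // nE.
  exact: logn2_mul4.
have logA : logn 2 `|A| = logn 2 n0 by apply: succn_inj; apply: succn_inj; rewrite -logN.
have logBC : logn 2 `|(B + C)%R| = (logn 2 n0).+1 by apply: succn_inj; rewrite -logN.
have log_gt0 : (0 < logn 2 n0)%N by rewrite -(pfactor_dvdn 1) // dvdn2.
have [_ A2 _] := logn2_parity A_gt0; have [_ BC2 BC4] := logn2_parity BC_gt0.
have {}A2 : (2 %| A)%Z by rewrite -A2 logA.
have {}BC4 : (4 %| B + C)%Z by rewrite -BC4 logBC.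
have B2 : ~~ (2 %| B)%Z.
  apply/negP => B2; apply: (gen 2) => //; split => //.
  by move: BC4 B2; clear; lia.
have odd_p p : prime p -> (p %| n)%N -> odd p ->
    ((n`_p)%N%:Z %| A)%Z /\ ((n`_p)%N%:Z %| B + C)%Z.
  move=> p_pr p_n p_odd; have [M [M_n n_M quarM]] := inf p p_pr p_n.
  have M_gt0 := dvdn_gt0 n_gt0 M_n.
  case: quarM => [[q|q]|[q|q]|[q|q]]; 
    first (by apply: quarter_odd_part q);
    by move: A2 BC4 B2 (quarter_parity M_gt0 q); clear; lia.
have n0_part p : ((n0`_p)%N %| (n`_p)%N)%N by apply: partn_dvd; rewrite // nE dvdn_mull.
have n0A : (n0%:Z %| A)%Z.
  apply: dvdz_part => // p p_pr p_n0; case: (even_prime p_pr) => [->|p_odd].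
    by rewrite dvdzE absz_nat p_part pfactor_dvdn // logA.
  have [|dA _] := odd_p p p_pr _ p_odd; first by rewrite nE dvdn_mull.
  exact: dvdz_dvdn dA.
apply: unit_multiple_A1 => //.
- rewrite dvdzE absz_nat; apply/negP => /(dvdn_leq_log 2 A_gt0).
  by rewrite lognM // logA ltnn.
- apply: dvdz_part; first by rewrite muln_gt0.
  move=> p p_pr; case: (even_prime p_pr) => [-> _|p_odd p_2n0].
    by rewrite dvdzE absz_nat p_part pfactor_dvdn // logBC lognM.
  have p_n : (p %| n)%N by rewrite (dvdn_trans p_2n0) // nE dvdn_pmul2r.
  have [_ dBC] := odd_p p p_pr p_n p_odd; apply: dvdz_dvdn dBC.
  by apply: partn_dvd; rewrite // nE dvdn_pmul2r.
- rewrite dvdzE absz_nat; apply/negP => /(dvdn_leq_log 2 BC_gt0).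
  by rewrite nE logn2_mul4 // logBC ltnn.
apply: coprimez_prime => // p p_pr p_n; case: (even_prime p_pr) => [->//|p_odd].
have [dA dBC] := odd_p p p_pr p_n p_odd; apply/negP => pB.
have p_part : (p %| n`_p)%N by rewrite p_part dvdn_exp ?logn_gt0 ?mem_primes ?p_pr ?n_gt0.
apply: (gen p p_pr p_n); split=> //; first exact: dvdz_dvdn dA.
by rewrite -(rpredDl _ pB); apply: dvdz_dvdn dBC.
Qed.

(** * n0 odd, elements of S of mixed parity: families A2 and A3 *)

Definition familyA3 (n n0 : nat) (S : {set 'Z_n}) :=
  exists d d' c' : nat,
    [/\ [/\ n0 = (d * d')%N, odd d, odd d', coprime d d'
          & (1 < d < d')%N /\ (d' < n0)%N],
        unique (fun x : nat =>
          [/\ (1 < x < n)%N,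
              (x%:Z = 0 %[mod 4])%Z,
              (x%:Z = 2 %[mod d%:Z])%Z
            & (x%:Z = - 2 %[mod d'%:Z])%Z]) c'
      & unit_multiple S (pm3 2 n0%:R c'%:R)].

Lemma dvdz_nat_eq (n x y : nat) : (x < n)%N -> (y < n)%N ->
  (n%:Z %| x%:Z - y%:Z)%Z -> x = y.
Proof.
by move=> x_n y_n; rewrite -eqz_mod_dvd !modz_nat !modn_small // eqz_nat => /eqP.
Qed.

Lemma dvdz_subC (d x y : int) : (d %| x - y)%Z = (d %| y - x)%Z.
Proof. by rewrite -opprB dvdz_oppr. Qed.

Lemma dvdz_sub_trans (d y x z : int) : (d %| x - y)%Z -> (d %| y - z)%Z -> (d %| x - z)%Z.
Proof. by move=> dxy dyz; rewrite -(subrK y x) -addrA rpredD. Qed.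

Lemma gcdn_dvdz (m : nat) (x : int) : ((gcdn `|x| m)%N%:Z %| x)%Z.
Proof. by rewrite dvdzE absz_nat dvdn_gcdl. Qed.

Lemma dvdz_gcdn (e m : nat) (x : int) :
  (e%:Z %| x)%Z -> (e %| m)%N -> (e %| gcdn `|x| m)%N.
Proof. by rewrite dvdzE absz_nat dvdn_gcd => -> ->. Qed.

Lemma coprime_gcdn_prime (m : nat) (x y : int) : (0 < m)%N ->
    (forall p, prime p -> (p %| m)%N -> (p%:Z %| x)%Z -> (p%:Z %| y)%Z -> False) ->
  coprime (gcdn `|x| m) (gcdn `|y| m).
Proof.
move=> m_gt0 ndvd; have g_gt0 : (0 < gcdn `|x| m)%N by rewrite gcdn_gt0 m_gt0 orbT.
have : coprimez (gcdn `|x| m)%N%:Z (gcdn `|y| m)%N%:Z.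
  apply: coprimez_prime => // p p_pr px; apply/negP; rewrite dvdzE !absz_nat => py.
  apply: (ndvd p p_pr (dvdn_trans px (dvdn_gcdr _ _))).
    by rewrite dvdzE (dvdn_trans px) // dvdn_gcdl.
  by rewrite dvdzE (dvdn_trans py) // dvdn_gcdl.
by rewrite coprimezE.
Qed.

(** The divisors are d = gcd(C - 2, n0) and d' = gcd(C + 2, n0). They are coprime, because C + 2 and
    C - 2 differ by 4 and n0 is odd, and each prime power of n0 divides one of them. Replacing C by
    -C exchanges them, so d can be taken to be the smaller. If d = 1, then C is 2 n0 - 2 modulo n;
    otherwise c' is the residue of C. *)
Lemma mixed_families n n0 (S : {set 'Z_n}) (C : int) :
    n = (4 * n0)%N -> odd n0 -> (1 < n0)%N -> (4 %| C)%Z ->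
    (forall p, prime p -> (p %| n0)%N ->
       ((n0`_p)%N%:Z %| C - 2)%Z \/ ((n0`_p)%N%:Z %| C + 2)%Z) ->
    unit_multiple S (pm3 2%:~R n0%:Z%:~R C%:~R) ->
  unit_multiple S (pm3 2 n0%:R (2 * n0%:R - 2)) \/ familyA3 n0 S.
Proof.
move=> nE odd_n0 n0_gt1.
wlog le_d : C / (gcdn `|(C - 2)%R| n0 <= gcdn `|(C + 2)%R| n0)%N.
  move=> main C4 parts mult.
  have [le_d|/ltnW le_d] := leqP (gcdn `|(C - 2)%R| n0) (gcdn `|(C + 2)%R| n0).
    exact: main le_d C4 parts mult.
  have E1 : - C - 2 = - (C + 2) by ring.
  have E2 : - C + 2 = - (C - 2) by ring.
  apply: (main (- C)); rewrite ?E1 ?E2 ?abszN ?dvdz_oppr //.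
    by move=> p p_pr p_n0; rewrite !dvdz_oppr; case: (parts p p_pr p_n0); auto.
  by rewrite mulrNz pm3C13 pm3N1 pm3C13.
move=> C4 parts mult; have n0_gt0 := ltnW n0_gt1.
have n_gt1 : (1 < n)%N by rewrite nE (leq_trans n0_gt1) // leq_pmull.
set d := gcdn _ _ in le_d; set d' := gcdn _ _ in le_d.
have d_dvd : (d%:Z %| C - 2)%Z by exact: gcdn_dvdz.
have d'_dvd : (d'%:Z %| C + 2)%Z by exact: gcdn_dvdz.
have d_n0 : (d %| n0)%N by exact: dvdn_gcdr.
have d'_n0 : (d' %| n0)%N by exact: dvdn_gcdr.
have odd_d : odd d := dvdn_odd d_n0 odd_n0.
have odd_d' : odd d' := dvdn_odd d'_n0 odd_n0.
have co : coprime d d'.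
  apply: coprime_gcdn_prime => // p p_pr p_n0 p1 p2.
  have odd_p := dvdn_odd p_n0 odd_n0.
  have : (p%:Z %| (C + 2) - (C - 2))%Z by rewrite rpredB.
  rewrite (_ : _ - _ = 4); last by ring.
  rewrite dvdzE absz_nat /= (@Euclid_dvdX 2 2 p) // andbT dvdn_prime2 // => /eqP p2'.
  by rewrite p2' in odd_p.
have n0E : n0 = (d * d')%N.
  apply/eqP; rewrite eqn_dvd Gauss_dvd // d_n0 d'_n0 /= andbT.
  apply/(dvdn_partP _ n0_gt0) => p; rewrite mem_primes => /and3P[p_pr _ p_n0].
  case: (parts p p_pr p_n0) => /dvdz_gcdn/(_ (dvdn_part p n0)) dvd.
    by rewrite dvdn_mulr.
  by rewrite dvdn_mull.
have dvd_n (x : int) : (4 %| x)%Z -> (d%:Z %| x)%Z -> (d'%:Z %| x)%Z -> (n%:Z %| x)%Z.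
  rewrite nE n0E -[X in (4 * X)%N]muln1 => x4 xd xd'.
  by rewrite dvdz_4mul3 ?coprimen1 ?x4 ?xd ?xd' ?dvd1z.
have [d1|d_neq1] := eqVneq d 1%N.
  left; apply: unit_multiple_trans mult _; rewrite -pm3_A2.
  apply: (@unit_multiple_int n 1); rewrite ?mul1r ?subrr ?dvdz0 //; try by left.
    by rewrite coprimezE coprimen1.
  left; apply: dvd_n.
  - have : odd n0 by []. move: C4; clear; lia.
  - by rewrite d1 dvd1z.
  rewrite (_ : _ - _ = C + 2 - n0%:Z * 2); last by ring.
  by rewrite rpredB // dvdz_mulr // dvdzE.
right.
have d_gt1 : (1 < d)%N by rewrite ltn_neqAle eq_sym d_neq1 odd_gt0.
have d_lt : (d < d')%N.
  rewrite ltn_neqAle le_d andbT; apply: contra d_neq1 => /eqP dd'.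
  by move: co; rewrite -dd' /coprime gcdnn.
have [c' c'_n c'C] := nat_residue C (ltnW n_gt1).
have c'4 : (4%:Z %| c'%:Z - C)%Z by apply: dvdz_dvdn c'C; rewrite nE dvdn_mulr.
have c'd : (d%:Z %| c'%:Z - C)%Z by apply: dvdz_dvdn c'C; rewrite nE dvdn_mull.
have c'd' : (d'%:Z %| c'%:Z - C)%Z by apply: dvdz_dvdn c'C; rewrite nE dvdn_mull.
have {}c'4 : (4 %| c'%:Z)%Z by rewrite -(subrK C c'%:Z) rpredD.
have {}c'd : (d%:Z %| c'%:Z - 2)%Z by apply: dvdz_sub_trans c'd d_dvd.
have {}c'd' : (d'%:Z %| c'%:Z + 2)%Z.
  by rewrite -[2]opprK; apply: dvdz_sub_trans c'd' _; rewrite opprK.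
exists d, d', c'; split.
- split=> //; rewrite d_gt1 d_lt; split=> //.
  by rewrite n0E -{1}[d']mul1n ltn_pmul2r // odd_gt0.
- split.
    split; [|by apply/eqP; rewrite eqz_mod_dvd subr0| exact/eqP/etrans/c'd/eqz_mod_dvd|].
      rewrite c'_n andbT ltnNge; apply/negP => c'_le1.
      have c'0 : c' = 0%N by case: c' c'4 c'_le1 {c'_n c'C c'd c'd'} => [|[|]].
      have := c'd; rewrite c'0 sub0r dvdz_oppr dvdzE absz_nat /= => /(dvdn_leq (isT : (0 < 2)%N)).
      by case: (d) odd_d d_gt1 => [|[|[|]]].
    by apply/eqP; rewrite eqz_mod_dvd opprK.
  move=> y [/andP[_ y_n] /eqP y4 /eqP yd /eqP yd'].
  move: y4 yd yd'; rewrite !eqz_mod_dvd subr0 opprK => y4 yd yd'.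
  apply: dvdz_nat_eq c'_n y_n _; apply: dvd_n; first by rewrite rpredB.
    by apply: dvdz_sub_trans c'd _; rewrite dvdz_subC.
  by rewrite -(opprK 2) in c'd' yd'; apply: dvdz_sub_trans c'd' _; rewrite dvdz_subC.
apply: unit_multiple_trans mult _.
rewrite !pmulrn; apply: (@unit_multiple_int n 1); rewrite ?mul1r ?subrr ?dvdz0 //; try by left.
  by rewrite coprimezE coprimen1.
by left; rewrite dvdz_subC.
Qed.

(** The sum of A and an even number is odd, so [quarter_parity] leaves at every prime only the
    alternatives in which A stands apart from B and C. Only the sign of C can still vary with the
    prime. *)
Lemma quarterly_mixed n n0 (A B C : int) : n = (4 * n0)%N -> odd n0 -> (1 < n0)%N ->
    jointly_coprime n A B C -> quarterly n A B C ->
    ~~ (2 %| A)%Z -> (4 %| B - 2)%Z -> (4 %| C)%Z ->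
  unit_multiple (pm3 (A%:~R : 'Z_n) B%:~R C%:~R) (pm3 2 n0%:R (2 * n0%:R - 2)) \/
  familyA3 n0 (pm3 (A%:~R : 'Z_n) B%:~R C%:~R).
Proof.
move=> nE odd_n0 n0_gt1 gen inf A2 B4 C4; have n0_gt0 := ltnW n0_gt1.
have n_gt1 : (1 < n)%N by rewrite nE (leq_trans n0_gt1) // leq_pmull.
have n_gt0 := ltnW n_gt1.
have n0_part p : ((n0`_p)%N %| (n`_p)%N)%N by apply: partn_dvd; rewrite // nE dvdn_mull.
have B2 : (2 %| B)%Z by move: B4; clear; lia.
have C2 : (2 %| C)%Z by move: C4; clear; lia.
have parts p : prime p -> (p %| n0)%N -> ((n0`_p)%N%:Z %| A)%Z /\
    (((n0`_p)%N%:Z %| B + C)%Z \/ ((n0`_p)%N%:Z %| B - C)%Z).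
  move=> p_pr p_n0; have p_odd := dvdn_odd p_n0 odd_n0.
  have [|M [M_n n_M quarM]] := inf p p_pr; first by rewrite nE dvdn_mull.
  have M_gt0 := dvdn_gt0 n_gt0 M_n.
  have excl X Y : (2 %| Y)%Z -> quarter M X A Y -> False.
    move=> Y2 q; have [AY2 _] := quarter_parity M_gt0 q.
    by rewrite (rpredDr _ Y2) (negbTE A2) in AY2.
  case: quarM => [[q|q]|[q|q]|[q|q]]; try by case: (excl _ _ _ q); rewrite ?dvdz_oppr.
    have [dA dBC] := quarter_odd_part p_pr p_odd n_gt0 n_M q.
    by split; [apply: dvdz_dvdn dA | left; apply: dvdz_dvdn dBC].
  have [dA dBC] := quarter_odd_part p_pr p_odd n_gt0 n_M q.
  by split; [apply: dvdz_dvdn dA | right; apply: dvdz_dvdn dBC].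
have n0A : (n0%:Z %| A)%Z.
  by apply: dvdz_part => // p p_pr p_n0; have [] := parts p p_pr p_n0.
(* B is even, hence not a unit, but B/2 is coprime to n; its inverse sends B to 2. *)
have /dvdzP[B' BE] := B2.
have B'2 : ~~ (2 %| B')%Z by move: B4; rewrite BE; clear; lia.
have p_part p : prime p -> (p %| n0)%N -> (p %| n0`_p)%N.
  by move=> p_pr p_n0; rewrite p_part dvdn_exp ?logn_gt0 ?mem_primes ?p_pr ?n0_gt0.
have coB' : coprimez n%:Z B'.
  apply: coprimez_prime => // p p_pr p_n; case: (even_prime p_pr) => [->//|p_odd].
  apply/negP => pB'; have pB : (p%:Z %| B)%Z by rewrite BE dvdz_mulr.
  have p_n0 : (p %| n0)%N.
    move: p_n; rewrite nE Euclid_dvdM // (@Euclid_dvdX 2 2 p) // andbT.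
    by rewrite dvdn_prime2 // => /orP[/eqP p2|//]; rewrite p2 in p_odd.
  have [pA pBC] := parts p p_pr p_n0; apply: (gen p p_pr p_n); split=> //.
    exact: dvdz_dvdn (p_part p p_pr p_n0) pA.
  case: pBC => /(dvdz_dvdn (p_part p p_pr p_n0)); first by rewrite rpredDl.
  by rewrite rpredBl.
have [q co_q qB'] := inverse_modz coB'.
have qB : (n%:Z %| q * B - 2)%Z.
  by rewrite (_ : _ - _ = (q * B' - 1) * 2) ?dvdz_mulr // BE; ring.
have q_odd : ~~ (2 %| q)%Z by apply: coprimez_odd co_q; rewrite nE dvdn_mulr.
apply: (@mixed_families _ _ _ (q * C)) => //.
- by rewrite dvdz_mull.
- move=> p p_pr p_n0; have [_ pBC] := parts p p_pr p_n0.
  have pB : ((n0`_p)%N%:Z %| q * B - 2)%Z.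
    by apply: dvdz_dvdn qB; rewrite nE dvdn_mull // dvdn_part.
  case: pBC => /(dvdz_mull q); [right | left].
    by rewrite (_ : q * C + 2 = q * (B + C) - (q * B - 2)); [rewrite rpredB|ring].
  by rewrite (_ : q * C - 2 = (q * B - 2) - q * (B - C)); [rewrite rpredB|ring].
rewrite pm3C12; apply: (unit_multiple_int (q := q)) => //; first by left.
  apply: odd_multiple => //; apply: contra A2; rewrite PoszM.
  by apply: dvdz_trans; rewrite dvdz_mulr.
by left; rewrite subrr dvdz0.
Qed.

(** * n0 odd, all elements of S odd: families A1 and A4 *)

Definition familyA4 (n n0 : nat) (S : {set 'Z_n}) :=
  exists d d' d'' b' c' : nat,
    [/\ [/\ n0 = (d * d' * d'')%N,
            [/\ odd d, odd d' & odd d''],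
            [/\ coprime d d', coprime d d'' & coprime d' d'']
          & (1 <= d < d')%N /\ (d' < d'' < n0)%N],
        (let P := fun x : nat =>
           [/\ (1 < x < n)%N,
               (x%:Z = 2 - d%:Z %[mod 4])%Z,
               (x%:Z = 0 %[mod d'%:Z])%Z,
               (x%:Z = - d%:Z %[mod d''%:Z])%Z
             & gcdn x d = 1%N] in
         P b' /\ forall x : nat, P x -> (b' <= x)%N),
        unique (fun x : nat =>
          [/\ (1 < x < n)%N,
              (x%:Z = 2 - d%:Z %[mod 4])%Z,
              (x%:Z = - b'%:Z %[mod d%:Z])%Z,
              (x%:Z = - d%:Z %[mod d'%:Z])%Z
            & (x%:Z = 0 %[mod d''%:Z])%Z]) c'
      & unit_multiple S (pm3 d%:R b'%:R c'%:R)].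

(** This is what [quarterly] says at the odd primes once the alternatives with a minus sign are
    excluded. *)
Definition splits3 (n0 : nat) (A B C : int) := forall p, prime p -> (p %| n0)%N ->
  [\/ ((n0`_p)%N%:Z %| A)%Z /\ ((n0`_p)%N%:Z %| B + C)%Z,
      ((n0`_p)%N%:Z %| B)%Z /\ ((n0`_p)%N%:Z %| A + C)%Z
    | ((n0`_p)%N%:Z %| C)%Z /\ ((n0`_p)%N%:Z %| A + B)%Z].

Lemma splits3C12 n0 A B C : splits3 n0 A B C -> splits3 n0 B A C.
Proof.
move=> H p p_pr p_n0; have [h|h|h] := H p p_pr p_n0.
- by constructor 2.
- by constructor 1.
- by constructor 3; rewrite addrC.
Qed.

Lemma splits3C23 n0 A B C : splits3 n0 A B C -> splits3 n0 A C B.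
Proof.
move=> H p p_pr p_n0; have [h|h|h] := H p p_pr p_n0.
- by constructor 1; rewrite addrC.
- by constructor 3.
- by constructor 2.
Qed.

Lemma jointly_coprimeC12 n0 A B C : jointly_coprime n0 A B C -> jointly_coprime n0 B A C.
Proof. by move=> H p p_pr p_n0 [? ? ?]; apply: (H p p_pr p_n0). Qed.

Lemma jointly_coprimeC23 n0 A B C : jointly_coprime n0 A B C -> jointly_coprime n0 A C B.
Proof. by move=> H p p_pr p_n0 [? ? ?]; apply: (H p p_pr p_n0). Qed.

Lemma prime_dvd_part p m : prime p -> (0 < m)%N -> (p %| m)%N -> (p %| m`_p)%N.
Proof.
by move=> p_pr m_gt0 p_m; rewrite p_part dvdn_exp ?logn_gt0 ?mem_primes ?p_pr ?m_gt0.
Qed.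

(** In the second and third alternatives a prime p dividing A would divide all three integers, and
    so it would in the first if it also divided B. *)
Lemma splits3_prime n0 A B C p : (0 < n0)%N -> jointly_coprime n0 A B C ->
    splits3 n0 A B C -> prime p -> (p %| n0)%N -> (p%:Z %| A)%Z ->
  ~~ (p%:Z %| B)%Z /\ ((n0`_p)%N%:Z %| B + C)%Z.
Proof.
move=> n0_gt0 gen spl p_pr p_n0 pA.
have p_part := dvdz_dvdn (prime_dvd_part p_pr n0_gt0 p_n0).
case: (spl p p_pr p_n0) => -[/[dup] /p_part pX X /[dup] /p_part pYZ YZ].
- split=> //; apply/negP => pB; apply: (gen p p_pr p_n0); split=> //.
  by rewrite -(rpredDl _ pB).
- by case: (gen p p_pr p_n0); split=> //; rewrite -(rpredDl _ pA).
- by case: (gen p p_pr p_n0); split=> //; rewrite -(rpredDl _ pA).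
Qed.

Lemma splits3_gcdn n0 A B C : (0 < n0)%N -> jointly_coprime n0 A B C ->
  splits3 n0 A B C -> ((gcdn `|A| n0)%N%:Z %| B + C)%Z.
Proof.
move=> n0_gt0 gen spl; apply: dvdz_part; first by rewrite gcdn_gt0 n0_gt0 orbT.
move=> p p_pr p_g; have p_n0 := dvdn_trans p_g (dvdn_gcdr _ _).
have pA := dvdz_dvdn p_g (gcdn_dvdz _ _).
have [_] := splits3_prime n0_gt0 gen spl p_pr p_n0 pA.
by apply: dvdz_dvdn; rewrite partn_dvd // dvdn_gcdr.
Qed.

Lemma splits3_coprime n0 A B C : (0 < n0)%N -> jointly_coprime n0 A B C ->
  splits3 n0 A B C -> coprime (gcdn `|A| n0) (gcdn `|B| n0).
Proof.
move=> n0_gt0 gen spl; apply: coprime_gcdn_prime => // p p_pr p_n0 pA pB.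
by have [] := splits3_prime n0_gt0 gen spl p_pr p_n0 pA; rewrite pB.
Qed.

Lemma coprime_dvd_eq1 d e : coprime d e -> (e %| d)%N -> e = 1%N.
Proof. by move=> /eqP <- /gcdn_idPr. Qed.

Lemma chinese_int (m m' : nat) (r r' : int) : coprime m m' ->
  exists x : int, (m%:Z %| x - r)%Z /\ (m'%:Z %| x - r')%Z.
Proof.
move=> co; have co' : coprimez m%:Z m'%:Z by rewrite coprimezE.
exists (zchinese m%:Z m'%:Z r r'); rewrite -!eqz_mod_dvd.
by rewrite (zchinese_modl co') (zchinese_modr co') !eqxx.
Qed.

(** The gcds of A, B, C with n0 are d, d', d''. By [splits3] they are pairwise coprime with product
    n0, and each divides the sum of the other two integers. If d' = 1, then d = 1 and n0 divides C,
    which gives family A1. Otherwise a unit q is built that sends A to d and B to the minimal b';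
    the image of C is then forced. *)
Lemma odd_families n n0 (A B C : int) : n = (4 * n0)%N -> odd n0 -> (1 < n0)%N ->
    jointly_coprime n0 A B C -> splits3 n0 A B C ->
    ~~ (2 %| A)%Z -> (4 %| A - B)%Z -> (4 %| A - C)%Z ->
    (gcdn `|A| n0 <= gcdn `|B| n0 <= gcdn `|C| n0)%N ->
  unit_multiple (pm3 (A%:~R : 'Z_n) B%:~R C%:~R) (pm3 1 n0%:R (2 * n0%:R - 1)) \/
  familyA4 n0 (pm3 (A%:~R : 'Z_n) B%:~R C%:~R).
Proof.
move=> nE odd_n0 n0_gt1 gen spl A2 AB4 AC4; have n0_gt0 := ltnW n0_gt1.
have n_gt1 : (1 < n)%N by rewrite nE (leq_trans n0_gt1) // leq_pmull.
have n_gt0 := ltnW n_gt1.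
have genBAC := jointly_coprimeC12 gen; have splBAC := splits3C12 spl.
have genCAB := jointly_coprimeC12 (jointly_coprimeC23 gen).
have splCAB := splits3C12 (splits3C23 spl).
have genBCA := jointly_coprimeC23 genBAC; have splBCA := splits3C23 splBAC.
have genACB := jointly_coprimeC23 gen; have splACB := splits3C23 spl.
set d := gcdn `|A| n0; set d' := gcdn `|B| n0; set d'' := gcdn `|C| n0.
move=> /andP[le_d le_d'].
have dA : (d%:Z %| A)%Z := gcdn_dvdz _ _.
have dB : (d'%:Z %| B)%Z := gcdn_dvdz _ _.
have dC : (d''%:Z %| C)%Z := gcdn_dvdz _ _.
have [d_n0 d'_n0 d''_n0] : [/\ d %| n0, d' %| n0 & d'' %| n0]%N.
  by rewrite !dvdn_gcdr.
have [odd_d odd_d' odd_d''] : [/\ odd d, odd d' & odd d''].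
  by split; apply: dvdn_odd odd_n0.
have co1 : coprime d d' := splits3_coprime n0_gt0 gen spl.
have co2 : coprime d d'' := splits3_coprime n0_gt0 genACB splACB.
have co3 : coprime d' d'' := splits3_coprime n0_gt0 genBCA splBCA.
have dBC : (d%:Z %| B + C)%Z := splits3_gcdn n0_gt0 gen spl.
have dAC : (d'%:Z %| A + C)%Z := splits3_gcdn n0_gt0 genBAC splBAC.
have dAB : (d''%:Z %| A + B)%Z := splits3_gcdn n0_gt0 genCAB splCAB.
have n0E : n0 = (d * d' * d'')%N.
  apply/eqP; rewrite eqn_dvd !Gauss_dvd ?coprimeMl ?co2 // d_n0 d'_n0 d''_n0 /= andbT.
  apply/(dvdn_partP _ n0_gt0) => p; rewrite mem_primes => /and3P[p_pr _ p_n0].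
  case: (spl p p_pr p_n0) => -[/dvdz_gcdn/(_ (dvdn_part p n0)) dvd _].
  - by rewrite -mulnA dvdn_mulr.
  - by rewrite mulnAC dvdn_mull.
  - by rewrite dvdn_mull.
have nE4 : n = (4 * (d * d' * d''))%N by rewrite -n0E.
have dvd_n x : (n%:Z %| x)%Z =
    [&& (4 %| x)%Z, (d%:Z %| x)%Z, (d'%:Z %| x)%Z & (d''%:Z %| x)%Z].
  by rewrite nE4 dvdz_4mul3.
have [d'1|d'_neq1] := eqVneq d' 1%N.
  have d1 : d = 1%N by apply/eqP; rewrite eqn_leq -{1}d'1 le_d odd_gt0.
  have d''E : d'' = n0 by rewrite n0E d1 d'1 !mul1n.
  left; rewrite pm3C13 pm3C23; rewrite d''E in dC dAB.
  have C2 : ~~ (2 %| C)%Z by move: A2 AC4; clear; lia.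
  have AB2 : (2 %| A + B)%Z by move: AB4; clear; lia.
  have AB4' : ~~ (4 %| A + B)%Z by move: AB4 A2; clear; lia.
  apply: unit_multiple_A1 => //.
  - by apply: contra C2; apply: dvdz_dvdn; rewrite dvdn_mulr.
  - by rewrite PoszM Gauss_dvdz ?AB2 // coprimezE /= coprime2n.
  - by apply: contra AB4'; apply: dvdz_dvdn; rewrite nE dvdn_mulr.
  apply: coprimez_prime => // p p_pr p_n; case: (even_prime p_pr) => [->//|p_odd].
  have p_n0 : (p %| n0)%N.
    move: p_n; rewrite nE Euclid_dvdM // (@Euclid_dvdX 2 2 p) // andbT.
    by rewrite dvdn_prime2 // => /orP[/eqP p2|//]; rewrite p2 in p_odd.
  apply/negP => /dvdz_gcdn/(_ p_n0); rewrite -/d d1 dvdn1 => /eqP p1.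
  by rewrite p1 in p_pr.
right.
have d'_gt1 : (1 < d')%N by rewrite ltn_neqAle eq_sym d'_neq1 odd_gt0.
have lt_d : (d < d')%N.
  rewrite ltn_neqAle le_d andbT; apply: contra d'_neq1 => /eqP dd'.
  by move: co1; rewrite dd' /coprime gcdnn.
have lt_d' : (d' < d'')%N.
  rewrite ltn_neqAle le_d' andbT; apply: contra d'_neq1 => /eqP dd'.
  by move: co3; rewrite -dd' /coprime gcdnn.
have d''_gt1 := ltn_trans d'_gt1 lt_d'.
have lt_d'' : (d'' < n0)%N.
  rewrite n0E -{1}[d'']mul1n ltn_pmul2r ?odd_gt0 //.
  by rewrite (leq_trans d'_gt1) // leq_pmull // odd_gt0.
(* A is invertible only away from d, so q is prescribed through A modulo m = n/d and through B,
   which is invertible there, modulo d. *)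
pose m := (4 * (d' * d''))%N.
have nEm : n = (m * d)%N.
  by rewrite nE4 /m -(mulnA d) -[RHS]mulnA [(d' * d'' * d)%N]mulnC.
have co_m : coprime m d.
  by rewrite /m !coprimeMl coprime_odd_4 // ![coprime _ d]coprime_sym co1 co2.
have coA : coprimez m%:Z A.
  apply: coprimez_prime; first by rewrite !muln_gt0 (odd_gt0 odd_d') (odd_gt0 odd_d'').
  move=> p p_pr p_m; apply/negP => pA; case: (even_prime p_pr) => [p2|p_odd].
    by case/negP: A2; move: pA; rewrite p2.
  have p_n0 : (p %| n0)%N.
    move: p_m; rewrite n0E /m Euclid_dvdM // (@Euclid_dvdX 2 2 p) // andbT.
    rewrite dvdn_prime2 // => /orP[/eqP p2|]; first by rewrite p2 in p_odd.
    by rewrite -mulnA; apply: dvdn_mull.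
  have p_d : (p %| d)%N by apply: dvdz_gcdn.
  have : (p %| gcdn m d)%N by rewrite dvdn_gcd p_m.
  by rewrite (eqP co_m) dvdn1 => /eqP p1; rewrite p1 in p_pr.
have coB : coprimez d%:Z B.
  apply: coprimez_prime; first exact: odd_gt0.
  move=> p p_pr p_d; have p_n0 := dvdn_trans p_d d_n0.
  by have [] := splits3_prime n0_gt0 gen spl p_pr p_n0 (dvdz_dvdn p_d dA).
have [A' _ A'A] := inverse_modz coA; have [B' _ B'B] := inverse_modz coB.
pose P (x : nat) := [&& (1 < x < n)%N, (x%:Z == 2 - d%:Z %[mod 4])%Z,
  (x%:Z == 0 %[mod d'%:Z])%Z, (x%:Z == - d%:Z %[mod d''%:Z])%Z & gcdn x d == 1%N].
(* For d odd, 2 - d is d modulo 4, so the conditions on b' and c' modulo 4 match the congruence of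
   A, B and C. *)
have d4 : (4 %| d%:Z - (2 - d%:Z))%Z by move: odd_d; clear; lia.
have exP : exists x, P x.
  (* Residue 1 modulo d is one way to be coprime to d; the minimal solution may have another. *)
  have [y0 [y01 y02]] := chinese_int 0 (- d%:Z) co3.
  have [y1 [y11 y12]] : exists y : int,
      (4 %| y - d%:Z)%Z /\ ((d' * d'')%N%:Z %| y - y0)%Z.
    by apply: (@chinese_int 4); rewrite coprime_odd_4 // oddM odd_d'.
  have [y [yE1 yE2]] := chinese_int y1 1 co_m.
  have [x x_n xy] := nat_residue y n_gt0; exists x.
  move: xy; rewrite dvd_n => /and4P[x4 xd xd' xd''].
  have {}x4 : (4 %| x%:Z - d%:Z)%Z.
    apply: dvdz_sub_trans x4 (dvdz_sub_trans _ y11).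
    by apply: dvdz_dvdn yE1; rewrite dvdn_mulr.
  have yy0 : ((d' * d'')%N%:Z %| y - y0)%Z.
    by apply: dvdz_sub_trans y12; apply: dvdz_dvdn yE1; rewrite dvdn_mull.
  have {}xd' : (d'%:Z %| x%:Z - 0)%Z.
    apply: dvdz_sub_trans xd' (dvdz_sub_trans _ y01).
    by apply: dvdz_dvdn yy0; rewrite dvdn_mulr.
  have {}xd'' : (d''%:Z %| x%:Z - (- d%:Z))%Z.
    apply: dvdz_sub_trans xd'' (dvdz_sub_trans _ y02).
    by apply: dvdz_dvdn yy0; rewrite dvdn_mull.
  have {}xd : (d%:Z %| x%:Z - 1)%Z by apply: dvdz_sub_trans yE2.
  rewrite /P x_n andbT !eqz_mod_dvd (dvdz_sub_trans x4 d4) xd' xd'' /=.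
  apply/andP; split.
    case: (x) xd' xd'' => [|[|]] //.
      rewrite sub0r opprK dvdzE !absz_nat => _ d''d.
      by rewrite (coprime_dvd_eq1 co2 d''d) in d''_gt1.
    by rewrite subr0 dvdzE !absz_nat dvdn1 (negbTE d'_neq1).
  have : coprimez d%:Z x%:Z.
    apply: coprimez_prime; first exact: odd_gt0.
    move=> p p_pr p_d; apply/negP => px.
    have : (p%:Z %| x%:Z - (x%:Z - 1))%Z by rewrite rpredB //; apply: dvdz_dvdn xd.
    by rewrite subKr dvdzE !absz_nat dvdn1 => /eqP p1; rewrite p1 in p_pr.
  by rewrite coprimezE !absz_nat coprime_sym.
case: (ex_minnP exP) => b' /and5P[/andP[b'_gt1 b'_n]].
rewrite !eqz_mod_dvd => b'4 b'd' b'd'' /eqP b'd b'_min.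
have b'4d : (4 %| b'%:Z - d%:Z)%Z by rewrite (dvdz_sub_trans b'4) // dvdz_subC.
have [q [qA0 qB0]] := chinese_int (d%:Z * A') (b'%:Z * B') co_m.
have qA : (m%:Z %| q * A - d%:Z)%Z.
  rewrite (_ : _ - _ = (q - d%:Z * A') * A + d%:Z * (A' * A - 1)); last by ring.
  by apply: rpredD; [apply: dvdz_mulr | apply: dvdz_mull].
have qB : (d%:Z %| q * B - b'%:Z)%Z.
  rewrite (_ : _ - _ = (q - b'%:Z * B') * B + b'%:Z * (B' * B - 1)); last by ring.
  by apply: rpredD; [apply: dvdz_mulr | apply: dvdz_mull].
(* A prime of m dividing q would divide d, and a prime of d dividing q would divide b'. This is
   where gcd(b', d) = 1 enters. *)
have co_q : coprimez n%:Z q.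
  apply: coprimez_prime => // p p_pr; rewrite nEm Euclid_dvdM //.
  move=> p_md; apply/negP => pq; case/orP: p_md => [p_m|p_d].
    have pd : (p%:Z %| d%:Z)%Z.
      rewrite -(subKr (q * A) d%:Z) rpredB ?dvdz_mulr //.
      exact: dvdz_dvdn qA.
    have : (p %| gcdn m d)%N by rewrite dvdn_gcd p_m.
    by rewrite (eqP co_m) dvdn1 => /eqP p1; rewrite p1 in p_pr.
  have pb' : (p%:Z %| b'%:Z)%Z.
    rewrite -(subKr (q * B) b'%:Z) rpredB ?dvdz_mulr //.
    exact: dvdz_dvdn qB.
  have : (p %| gcdn b' d)%N by rewrite dvdn_gcd p_d andbT.
  by rewrite b'd dvdn1 => /eqP p1; rewrite p1 in p_pr.
have qA4 : (4 %| q * A - d%:Z)%Z by apply: dvdz_dvdn qA; rewrite dvdn_mulr.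
have qAd' : (d'%:Z %| q * A - d%:Z)%Z.
  by apply: dvdz_dvdn qA; rewrite dvdn_mull // dvdn_mulr.
have qAd'' : (d''%:Z %| q * A - d%:Z)%Z.
  by apply: dvdz_dvdn qA; rewrite dvdn_mull // dvdn_mull.
have qC4 : (4 %| q * C - d%:Z)%Z.
  rewrite (_ : _ - _ = (q * A - d%:Z) - q * (A - C)); last by ring.
  by rewrite rpredB // dvdz_mull.
have qCd : (d%:Z %| q * C + b'%:Z)%Z.
  rewrite (_ : _ + _ = q * (B + C) - (q * B - b'%:Z)); last by ring.
  by rewrite rpredB // dvdz_mull.
have qCd' : (d'%:Z %| q * C + d%:Z)%Z.
  rewrite (_ : _ + _ = q * (A + C) - (q * A - d%:Z)); last by ring.
  by rewrite rpredB // dvdz_mull.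
have [c' c'_n c'C] := nat_residue (q * C) n_gt0.
move: (c'C); rewrite dvd_n => /and4P[c'4 c'd c'd' c'd''].
have {}c'4 : (4 %| c'%:Z - (2 - d%:Z))%Z.
  exact: dvdz_sub_trans c'4 (dvdz_sub_trans qC4 d4).
have {}c'd : (d%:Z %| c'%:Z - (- b'%:Z))%Z.
  by apply: dvdz_sub_trans c'd _; rewrite opprK.
have {}c'd' : (d'%:Z %| c'%:Z - (- d%:Z))%Z.
  by apply: dvdz_sub_trans c'd' _; rewrite opprK.
have {}c'd'' : (d''%:Z %| c'%:Z - 0)%Z.
  by apply: dvdz_sub_trans c'd'' _; rewrite subr0 dvdz_mull.
exists d, d', d'', b', c'; split.
- by split=> //; rewrite odd_gt0 // lt_d lt_d' lt_d''.
- split; last first.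
    move=> x [x1 /eqP x2 /eqP x3 /eqP x4 x5]; apply: b'_min.
    by rewrite /P x1 x2 x3 x4 x5 eqxx.
  by split=> //; [by rewrite b'_gt1 | | |]; apply/eqP; rewrite eqz_mod_dvd.
- split.
    split; try by apply/eqP; rewrite eqz_mod_dvd.
    rewrite c'_n andbT; case: (c') c'd' c'd'' => [|[|]] //.
      rewrite sub0r opprK dvdzE !absz_nat => d'd _.
      by rewrite (coprime_dvd_eq1 co1 d'd) in d'_gt1.
    by move=> _; rewrite subr0 dvdzE !absz_nat dvdn1 => /eqP d''1; rewrite d''1 in d''_gt1.
  move=> y [/andP[_ y_n] /eqP y4 /eqP yd /eqP yd' /eqP yd''].
  move: y4 yd yd' yd''; rewrite !eqz_mod_dvd => y4 yd yd' yd''.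
  apply: dvdz_nat_eq c'_n y_n _; rewrite dvd_n; apply/and4P; split.
  - by apply: dvdz_sub_trans c'4 _; rewrite dvdz_subC.
  - by apply: dvdz_sub_trans c'd _; rewrite dvdz_subC.
  - by apply: dvdz_sub_trans c'd' _; rewrite dvdz_subC.
  - by apply: dvdz_sub_trans c'd'' _; rewrite dvdz_subC.
rewrite !pmulrn; apply: (unit_multiple_int (q := q)) => //; left; last by rewrite dvdz_subC.
  by rewrite dvd_n qA4 qAd' qAd'' rpredB ?dvdz_mull.
rewrite dvd_n qB /=; apply/and3P; split.
- rewrite (_ : _ - _ = (q * A - d%:Z) - q * (A - B) - (b'%:Z - d%:Z)); last by ring.
  by rewrite rpredB // rpredB // dvdz_mull.
- by rewrite rpredB ?dvdz_mull // -[b'%:Z]subr0.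
rewrite (_ : _ - _ = q * (A + B) - (q * A - d%:Z) - (b'%:Z - (- d%:Z))); last by ring.
by rewrite rpredB // rpredB // dvdz_mull.
Qed.

(** With A, B, C odd and congruent modulo 4, an alternative with a minus sign would make the element
    standing apart even. So [splits3] holds, and its symmetry allows the gcds with n0 to be
    sorted. *)
Lemma quarterly_odd n n0 (A B C : int) : n = (4 * n0)%N -> odd n0 -> (1 < n0)%N ->
    jointly_coprime n A B C -> quarterly n A B C ->
    ~~ (2 %| A)%Z -> (4 %| A - B)%Z -> (4 %| A - C)%Z ->
  unit_multiple (pm3 (A%:~R : 'Z_n) B%:~R C%:~R) (pm3 1 n0%:R (2 * n0%:R - 1)) \/
  familyA4 n0 (pm3 (A%:~R : 'Z_n) B%:~R C%:~R).
Proof.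
move=> nE odd_n0 n0_gt1 gen inf A2 AB4 AC4; have n0_gt0 := ltnW n0_gt1.
have n_gt0 : (0 < n)%N by rewrite nE muln_gt0.
have n0_part p : ((n0`_p)%N %| (n`_p)%N)%N by apply: partn_dvd; rewrite // nE dvdn_mull.
have gen0 : jointly_coprime n0 A B C.
  by move=> p p_pr p_n0; apply: gen => //; rewrite nE dvdn_mull.
have B2 : ~~ (2 %| B)%Z by move: A2 AB4; clear; lia.
have C2 : ~~ (2 %| C)%Z by move: A2 AC4; clear; lia.
have BC4 : (4 %| B - C)%Z.
  by rewrite (_ : B - C = (A - C) - (A - B)); [rewrite rpredB | ring].
have spl : splits3 n0 A B C.
  move=> p p_pr p_n0; have p_odd := dvdn_odd p_n0 odd_n0.
  have [|M [M_n n_M quarM]] := inf p p_pr; first by rewrite nE dvdn_mull.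
  have M_gt0 := dvdn_gt0 n_gt0 M_n.
  have excl X Y Z : ~~ (2 %| X)%Z -> (4 %| Y - Z)%Z -> quarter M X Y (- Z) -> False.
    by move=> X2 YZ4 q; have [_] := quarter_parity M_gt0 q; rewrite YZ4 (negbTE X2).
  have parts X Y Z : quarter M X Y Z ->
      ((n0`_p)%N%:Z %| X)%Z /\ ((n0`_p)%N%:Z %| Y + Z)%Z.
    move=> q; have [dX dYZ] := quarter_odd_part p_pr p_odd n_gt0 n_M q.
    by split; [apply: dvdz_dvdn dX | apply: dvdz_dvdn dYZ].
  case: quarM => [[q|q]|[q|q]|[q|q]].
  - by constructor 1; apply: parts.
  - by case: (excl _ _ _ A2 BC4 q).
  - by constructor 2; apply: parts.
  - by case: (excl _ _ _ B2 AC4 q).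
  - by constructor 3; apply: parts.
  - by case: (excl _ _ _ C2 AB4 q).
pose hyps X Y Z := [/\ jointly_coprime n0 X Y Z, splits3 n0 X Y Z, ~~ (2 %| X)%Z,
  (4 %| X - Y)%Z & (4 %| X - Z)%Z].
pose concl X Y Z :=
  unit_multiple (pm3 (X%:~R : 'Z_n) Y%:~R Z%:~R) (pm3 1 n0%:R (2 * n0%:R - 1)) \/
  familyA4 n0 (pm3 (X%:~R : 'Z_n) Y%:~R Z%:~R).
have hyps12 X Y Z : hyps X Y Z -> hyps Y X Z.
  move=> [gX sX X2 XY4 XZ4]; split.
  - exact: jointly_coprimeC12.
  - exact: splits3C12.
  - by move: X2 XY4; clear; lia.
  - by rewrite dvdz_subC.
  - by apply: dvdz_sub_trans XZ4; rewrite dvdz_subC.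
have hyps23 X Y Z : hyps X Y Z -> hyps X Z Y.
  move=> [gX sX X2 XY4 XZ4]; split => //; [exact: jointly_coprimeC23 | exact: splits3C23].
have concl12 X Y Z : concl X Y Z -> concl Y X Z by rewrite /concl pm3C12.
have concl23 X Y Z : concl X Y Z -> concl X Z Y by rewrite /concl pm3C23.
have sorted X Y Z : hyps X Y Z ->
    (gcdn `|X| n0 <= gcdn `|Y| n0 <= gcdn `|Z| n0)%N -> concl X Y Z.
  by move=> [*]; apply: odd_families.
have hABC : hyps A B C by [].
pose G (X : int) := gcdn `|X| n0.
rewrite -/(concl A B C).
have [AB|/ltnW BA] := leqP (G A) (G B); have [BC|/ltnW CB] := leqP (G B) (G C);
  have [AC|/ltnW CA] := leqP (G A) (G C).
- by apply: sorted => //; apply/andP.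
- by apply: sorted => //; apply/andP.
- by apply/concl23/sorted; [exact: hyps23 | apply/andP].
- by apply/concl23/concl12/sorted; [exact/hyps12/hyps23 | apply/andP].
- by apply/concl12/sorted; [exact: hyps12 | apply/andP].
- by apply/concl12/concl23/sorted; [exact/hyps23/hyps12 | apply/andP].
- by apply/concl12/concl23/concl12/sorted; [exact/hyps12/hyps23/hyps12 | apply/andP].
- by apply/concl12/concl23/concl12/sorted; [exact/hyps12/hyps23/hyps12 | apply/andP].
Qed.

(** * Both implications for orders not divisible by 3 *)

Definition int_triple n (S : {set 'Z_n}) (A B C : int) :=
  S = pm3 A%:~R B%:~R C%:~R.

Lemma int_triple_exists n (S : {set 'Z_n}) (a b c : 'Z_n) : S = pm3 a b c ->
  exists A B C : int, int_triple S A B C.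
Proof.
move=> SE; exists (a : nat)%:Z, (b : nat)%:Z, (c : nat)%:Z.
by rewrite /int_triple !Zp_intr.
Qed.

Lemma int_tripleC12 n (S : {set 'Z_n}) A B C : int_triple S A B C -> int_triple S B A C.
Proof. by rewrite /int_triple => ->; rewrite pm3C12. Qed.

Lemma int_tripleC23 n (S : {set 'Z_n}) A B C : int_triple S A B C -> int_triple S A C B.
Proof. by rewrite /int_triple => ->; rewrite pm3C23. Qed.

Lemma int_tripleN1 n (S : {set 'Z_n}) A B C : int_triple S A B C -> int_triple S (- A) B C.
Proof. by rewrite /int_triple => ->; rewrite mulrNz pm3N1. Qed.

Lemma generate_jointly_coprime n (S : {set 'Z_n}) A B C : (1 < n)%N ->
    <<S>>%g = [set: 'Z_n] -> int_triple S A B C ->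
  jointly_coprime n A B C.
Proof.
move=> n_gt1 gen SE p p_pr p_n [pA pB pC].
by rewrite SE in gen; apply: (generate_pm3 n_gt1 (prime_gt1 p_pr) p_n gen pA pB pC).
Qed.

Lemma distance_magic_quarterly n (S : {set 'Z_n}) A B C : (1 < n)%N -> ~~ (3 %| n)%N ->
    #|S| = 6%N -> distance_magic (circ S) -> int_triple S A B C ->
  quarterly n A B C.
Proof.
move=> n_gt1 n3 card6 dm SE p p_pr p_n; rewrite SE in card6 dm.
exact: distance_magic_quarter card6 dm p_pr p_n.
Qed.

(** The root for the prime 2 selects the case. If n0 is odd, it makes X odd and Y + Z equal to 2
    modulo 4. Then Y and Z are either 0 and 2 modulo 4 in some order, or odd and congruent modulo 4;
    in the latter case a change of sign makes X congruent to them. *)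
Lemma familiesA_necessary n (S : {set 'Z_n}) (a b c : 'Z_n) : (7 <= n)%N ->
    S = pm3 a b c -> #|S| = 6%N -> <<S>>%g = [set: 'Z_n] -> ~~ (3 %| n)%N ->
    distance_magic (circ S) ->
  exists n0 : nat, [/\ n = (4 * n0)%N, (2 <= n0)%N &
    [\/ unit_multiple S (pm3 1 n0%:R (2 * n0%:R - 1)),
        unit_multiple S (pm3 2 n0%:R (2 * n0%:R - 2)), familyA3 n0 S | familyA4 n0 S]].
Proof.
move=> n_ge7 SE card6 gen n3 dm; have n_gt1 : (1 < n)%N by apply: leq_trans n_ge7.
have n_gt0 := ltnW n_gt1.
have cop X Y Z (SX : int_triple S X Y Z) := generate_jointly_coprime n_gt1 gen SX.
have inf X Y Z (SX : int_triple S X Y Z) := distance_magic_quarterly n_gt1 n3 card6 dm SX.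
have [A [B [C SABC]]] := int_triple_exists SE.
have n4 : (4 %| n)%N.
  have [N [N_n _ quarN]] := inf _ _ _ SABC _ (pdiv_prime n_gt1) (pdiv_dvd n).
  have N_gt0 := dvdn_gt0 n_gt0 N_n.
  apply: dvdn_trans N_n; rewrite (@pfactor_dvdn 2 2) //.
  by case: quarN => [[q|q]|[q|q]|[q|q]]; have [-> _ _ _] := quarter_logn N_gt0 q.
have /dvdnP[n0 n0E] := n4; have {n0E} nE : n = (4 * n0)%N by rewrite mulnC.
have n0_gt1 : (1 < n0)%N by move: n_ge7; rewrite nE; case: n0 {nE} => [|[|]].
exists n0; split=> //; have n0_gt0 := ltnW n0_gt1.
have p2_n : (2 %| n)%N by rewrite nE dvdn_mulr.
have [N [N_n n_N quarN]] := inf _ _ _ SABC 2%N isT p2_n.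
have N_gt0 := dvdn_gt0 n_gt0 N_n.
have main X Y Z : int_triple S X Y Z -> quarter N X Y Z ->
    [\/ unit_multiple S (pm3 1 n0%:R (2 * n0%:R - 1)),
        unit_multiple S (pm3 2 n0%:R (2 * n0%:R - 2)), familyA3 n0 S | familyA4 n0 S].
  move=> SXYZ q; have [odd_n0|even_n0] := boolP (odd n0); last first.
    constructor 1; rewrite SXYZ.
    exact: quarterly_even (cop _ _ _ SXYZ) (inf _ _ _ SXYZ) N_n n_N q.
  have X2 : ~~ (2 %| X)%Z.
    have [E _ X_gt0 _] := quarter_logn N_gt0 q; have [<- _ _] := logn2_parity X_gt0.
    move: E; rewrite (eq_logn_part _ n_gt0 N_n n_N) // nE logn2_mul4 // => -[<-].
    by rewrite lognE dvdn2 odd_n0 !andbF.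
  have [YZ2 XYZ4] := quarter_parity N_gt0 q.
  have {}XYZ4 : ~~ (4 %| Y + Z)%Z by rewrite -XYZ4.
  have mixed Y' Z' : int_triple S X Y' Z' -> (4 %| Y' - 2)%Z -> (4 %| Z')%Z ->
      [\/ unit_multiple S (pm3 1 n0%:R (2 * n0%:R - 1)),
        unit_multiple S (pm3 2 n0%:R (2 * n0%:R - 2)), familyA3 n0 S | familyA4 n0 S].
    move=> SX Y4 Z4; rewrite SX.
    have [m|m] := quarterly_mixed nE odd_n0 n0_gt1 (cop _ _ _ SX) (inf _ _ _ SX) X2 Y4 Z4.
      by constructor 2.
    by constructor 3.
  have all_odd X' : int_triple S X' Y Z -> ~~ (2 %| X')%Z -> (4 %| X' - Y)%Z ->
      (4 %| X' - Z)%Z ->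
      [\/ unit_multiple S (pm3 1 n0%:R (2 * n0%:R - 1)),
        unit_multiple S (pm3 2 n0%:R (2 * n0%:R - 2)), familyA3 n0 S | familyA4 n0 S].
    move=> SX X'2 Y4 Z4; rewrite SX.
    have [m|m] := quarterly_odd nE odd_n0 n0_gt1 (cop _ _ _ SX) (inf _ _ _ SX) X'2 Y4 Z4.
      by constructor 1.
    by constructor 4.
  have [Y2|Y2] := boolP (2 %| Y)%Z.
    have [Y4|Y4] := boolP (4 %| Y)%Z.
      apply: (mixed Z Y) => //; first exact: int_tripleC23.
      by move: YZ2 XYZ4 Y4; clear; lia.
    by apply: (mixed Y Z) => //; move: Y2 YZ2 XYZ4 Y4; clear; lia.
  have [XY4|XY4] := boolP (4 %| X - Y)%Z.
    by apply: (all_odd X) => //; move: Y2 YZ2 XYZ4 XY4; clear; lia.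
  apply: (all_odd (- X)); first exact: int_tripleN1.
  - by rewrite dvdz_oppr.
  - by move: X2 Y2 XY4; clear; lia.
  - by move: X2 Y2 YZ2 XYZ4 XY4; clear; lia.
have neg X Y Z : int_triple S X Y Z -> int_triple S X Y (- Z).
  by move=> /int_tripleC23/int_tripleC12/int_tripleN1/int_tripleC12/int_tripleC23.
case: quarN => [[|]|[|]|[|]]; apply: main => //.
- exact: neg.
- exact: int_tripleC12.
- exact/neg/int_tripleC12.
- exact/int_tripleC12/int_tripleC23.
- exact/neg/int_tripleC12/int_tripleC23.
Qed.

Lemma dvdz_4odd (d : nat) (x : int) : odd d ->
  ((4 * d)%N%:Z %| x)%Z = (4 %| x)%Z && (d%:Z %| x)%Z.
Proof.
by move=> odd_d; rewrite PoszM Gauss_dvdz // coprimezE /= coprime_odd_4.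
Qed.

Lemma modz_eq_dvdz (d x y : int) : (x = y %[mod d])%Z -> (d %| x - y)%Z.
Proof. by rewrite -eqz_mod_dvd => /eqP. Qed.

(** In A3 the element n0 stands apart for both moduli, while 2 is paired with -c' modulo 4d and with
    c' modulo 4d'. In A4 the element standing apart is d, b' or c' for the moduli 4d, 4d' and 4d''
    respectively. *)
Lemma familiesA_sufficient n n0 (S : {set 'Z_n}) : n = (4 * n0)%N -> (2 <= n0)%N ->
    #|S| = 6%N ->
    [\/ unit_multiple S (pm3 1 n0%:R (2 * n0%:R - 1)),
        unit_multiple S (pm3 2 n0%:R (2 * n0%:R - 2)), familyA3 n0 S | familyA4 n0 S] ->
  distance_magic (circ S).
Proof.
move=> nE n0_gt1 card6; have n0_gt0 := ltnW n0_gt1.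
have n_gt1 : (1 < n)%N by rewrite nE (leq_trans n0_gt1) // leq_pmull.
have reduce T : unit_multiple S T -> (#|T| = 6%N -> distance_magic (circ T)) ->
    distance_magic (circ S).
  move=> mult dmT; apply: distance_magic_unit_multiple (mult) (dmT _).
  by rewrite (card_unit_multiple mult).
case=> [mult|mult|[d [d' [c' [H1 [H2 _] mult]]]]|[d [d' [d'' [b' [c' [H1 [H2 _] [H3 _] mult]]]]]]];
  apply: reduce mult _.
- rewrite -pm3_A1 pm3C12; apply: distance_magic_antiperiodic nE n0_gt0 _ _.
    by rewrite subrr dvdz0.
  by rewrite addrCA subrr addr0 subrr dvdz0.
- rewrite -pm3_A2 pm3C12; apply: distance_magic_antiperiodic nE n0_gt0 _ _.
    by rewrite subrr dvdz0.
  by rewrite addrCA subrr addr0 subrr dvdz0.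
- move: H1 H2 => [n0E odd_d odd_d' co _] [_ c4 cd cd'].
  move: (modz_eq_dvdz c4) (modz_eq_dvdz cd) (modz_eq_dvdz cd').
  rewrite subr0 opprK => {}c4 {}cd {}cd'.
  rewrite !pmulrn pm3C12; apply: (@distance_magic_mixed_radix _ d d' 1).
  - by rewrite muln1 -n0E.
  - by [].
  - by rewrite !coprimen1.
  - rewrite -(opprK c'%:Z); apply/antiperiodic_sum0N3/antiperiodic_sum0_pair.
      rewrite dvdz_4odd // n0E PoszM (_ : _ - _ = d%:Z * (2 * (d'%:Z - 1))); last by ring.
      by rewrite [(d%:Z %| _)%Z]dvdz_mulr // andbT dvdz_mull //; move: odd_d'; clear; lia.
    rewrite dvdz_4odd //; apply/andP; split.
      by move: odd_d c4; clear; lia.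
    rewrite (_ : _ - _ = - (c'%:Z - 2) - d%:Z * 2); last by ring.
    by rewrite rpredB ?dvdz_oppr // dvdz_mulr.
  - apply: antiperiodic_sum0_pair.
      rewrite dvdz_4odd // n0E PoszM (_ : _ - _ = d'%:Z * (2 * (d%:Z - 1))); last by ring.
      by rewrite [(d'%:Z %| _)%Z]dvdz_mulr // andbT dvdz_mull //; move: odd_d; clear; lia.
    rewrite dvdz_4odd //; apply/andP; split.
      by move: odd_d' c4; clear; lia.
    rewrite (_ : _ - _ = (c'%:Z + 2) - d'%:Z * 2); last by ring.
    by rewrite rpredB // dvdz_mulr.
  - by left.
move: H1 H2 H3 => [n0E [odd_d odd_d' odd_d''] cos _] [[_ b4 bd' bd'' _]] [_ c4 cd cd' cd''].
move: (modz_eq_dvdz b4) (modz_eq_dvdz bd') (modz_eq_dvdz bd'').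
move: (modz_eq_dvdz c4) (modz_eq_dvdz cd) (modz_eq_dvdz cd') (modz_eq_dvdz cd'').
rewrite !subr0 !opprK => {}c4 {}cd {}cd' {}cd'' {}b4 {}bd' {}bd''.
rewrite !pmulrn; apply: (@distance_magic_mixed_radix _ d d' d'') => //.
- by rewrite -n0E.
- apply: antiperiodic_sum0_pair; first by rewrite subrr dvdz0.
  rewrite dvdz_4odd //; apply/andP; split; first by move: odd_d b4 c4; clear; lia.
  by rewrite rpredB ?dvdz_mull // addrC.
- apply/antiperiodic_sum0C12/antiperiodic_sum0_pair.
    rewrite dvdz_4odd // -mulrBr; apply/andP; split.
      by move: odd_d odd_d' b4; clear; lia.
    by rewrite dvdz_mull // rpredB.
  rewrite dvdz_4odd //; apply/andP; split; first by move: odd_d odd_d' c4; clear; lia.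
  by rewrite rpredB ?dvdz_mull // addrC.
- right; apply/antiperiodic_sum0C13/antiperiodic_sum0_pair.
    rewrite dvdz_4odd // -mulrBr; apply/andP; split.
      by move: odd_d odd_d'' c4; clear; lia.
    by rewrite dvdz_mull // rpredB.
  rewrite dvdz_4odd //; apply/andP; split; first by move: odd_d odd_d'' b4; clear; lia.
  by rewrite rpredB ?dvdz_mull.
Qed.

(** * Orders not divisible by 4 *)

Definition familyB2 (n n0 : nat) (S : {set 'Z_n}) :=
  exists (d d' : nat) (delta : int) (c' : nat),
    [/\ [/\ n0 = (d * d')%N, coprime d d', (1 < d < d')%N,
            coprime d 3 & coprime d' 3],
        (delta = - 1 \/ delta = 1) /\ (n0%:Z = delta %[mod 3])%Z,
        unique (fun x : nat =>
          [/\ (1 <= x <= n - 1)%N,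
              (x%:Z = 0 %[mod 3])%Z,
              (x%:Z = 1 %[mod d%:Z])%Z
            & (x%:Z = - 1 %[mod d'%:Z])%Z]) c'
      & unit_multiple S (pm3 1 (n0%:R + delta%:~R) c'%:R)].

Definition thirdly (n : nat) (A B C : int) := forall p, prime p -> (p %| n)%N ->
  exists (N : nat) (B' C' : int), [/\ (N %| n)%N, (n`_p %| N)%N,
    B' = B \/ B' = - B, C' = C \/ C' = - C & thirds N A B' C'].

Lemma logn3_dvdz (x : int) : (0 < `|x|)%N -> (0 < logn 3 `|x|)%N = (3 %| x)%Z.
Proof. by move=> x_gt0; rewrite -(pfactor_dvdn 1) // dvdzE. Qed.

(** All three differences miss N by exactly one factor 3. Hence 3 divides N, which makes n divisible
    by 3, and either all three differences are divisible by 3 or none is. *)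
Lemma thirds_logn N A B C : (0 < N)%N -> thirds N A B C ->
  [/\ (logn 3 `|(A - B)%R|).+1 = logn 3 N, (logn 3 `|(A - C)%R|).+1 = logn 3 N
    & [/\ (3 %| A - B)%Z = (1 < logn 3 N)%N, (3 %| A - C)%Z = (1 < logn 3 N)%N
        & (3 %| B - C)%Z = (1 < logn 3 N)%N]].
Proof.
move=> N_gt0 [AB3 AC3 AB AC BC].
have BC3 : (N%:Z %| 3 * (B - C))%Z.
  by rewrite (_ : _ * _ = 3 * (A - C) - 3 * (A - B)); [rewrite rpredB | ring].
have step x : (N%:Z %| 3 * x)%Z -> ~~ (N%:Z %| x)%Z ->
    (logn 3 `|x|).+1 = logn 3 N /\ (3 %| x)%Z = (1 < logn 3 N)%N.
  move=> x3 x1; have [x_gt0 ->] := @logn_dvd_succ 3 N x isT N_gt0 x3 x1.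
  by rewrite -logn3_dvdz.
have [-> ->] := step _ AB3 AB; have [-> ->] := step _ AC3 AC.
by have [_ ->] := step _ BC3 BC.
Qed.

Lemma thirds_part p n N A B C : prime p -> p != 3%N -> (0 < n)%N -> (n`_p %| N)%N ->
    thirds N A B C ->
  ((n`_p)%N%:Z %| A - B)%Z /\ ((n`_p)%N%:Z %| A - C)%Z.
Proof.
move=> p_pr p3 n_gt0 n_N [AB3 AC3 _ _ _].
have co3 : coprimez p%:Z 3 by rewrite coprimezE /= prime_coprime // dvdn_prime2.
by split; [apply: odd_part_dvd co3 n_N AB3 | apply: odd_part_dvd co3 n_N AC3].
Qed.

Lemma pm3_B1 n n0 : pm3 ((1 : int)%:~R : 'Z_n) (n0%:Z - 1)%:~R (n0%:Z + 1)%:~R =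
  pm3 1 (n0%:R - 1) (n0%:R + 1).
Proof. by rewrite rmorphB rmorphD /= -!pmulrn. Qed.

Lemma modz3_unit (q i j : int) : ~~ (3 %| q)%Z -> ~~ (3 %| i)%Z -> ~~ (3 %| j)%Z ->
    ~~ (3 %| i - j)%Z ->
  (3 %| q * i - 1)%Z /\ (3 %| q * j + 1)%Z \/ (3 %| q * j - 1)%Z /\ (3 %| q * i + 1)%Z.
Proof.
move=> q3 i3 j3 ij3.
have mul3 x : ~~ (3 %| x)%Z -> ~~ (3 %| q * x)%Z.
  move=> x3; rewrite Gauss_dvdzr // coprimezE prime_coprime //; exact: q3.
have := mul3 _ i3; have := mul3 _ j3; have := mul3 _ ij3; rewrite mulrBr.
by move: (q * i) (q * j); clear; lia.
Qed.

(** B and C are A + i n0 and A + j n0, where i and j are the two nonzero residues modulo 3. The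
    inverse q of A sends them to 1 + n0 and 1 - n0 in some order. *)
Lemma unit_multiple_B1 n n0 (A B C : int) : n = (3 * n0)%N -> (1 < n)%N ->
    coprimez n%:Z A -> (n0%:Z %| B - A)%Z -> (n0%:Z %| C - A)%Z ->
    ~~ (n%:Z %| B - A)%Z -> ~~ (n%:Z %| C - A)%Z -> ~~ (n%:Z %| B - C)%Z ->
  unit_multiple (pm3 (A%:~R : 'Z_n) B%:~R C%:~R) (pm3 1 (n0%:R - 1) (n0%:R + 1)).
Proof.
move=> nE n_gt1 co /dvdzP[i iE] /dvdzP[j jE].
have BC : B - C = (i - j) * n0%:Z.
  by rewrite mulrBl -iE -jE; ring.
have dvd_n k : (3 %| k)%Z -> (n%:Z %| k * n0%:Z)%Z.
  by case/dvdzP => k' ->; rewrite nE PoszM -mulrA dvdz_mull.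
rewrite BC iE jE => /(contra (dvd_n _)) i3 /(contra (dvd_n _)) j3 /(contra (dvd_n _)) ij3.
have [q co_q qA] := inverse_modz co.
have q3 : ~~ (3 %| q)%Z.
  apply/negP => q3; have : (3 %| q * A - (q * A - 1))%Z.
    by rewrite rpredB ?dvdz_mulr //; apply: dvdz_dvdn qA; rewrite nE dvdn_mulr.
  by rewrite subKr.
have image X k : X - A = k * n0%:Z ->
    ((3 %| q * k - 1)%Z -> (n%:Z %| q * X - (n0%:Z + 1))%Z) /\
    ((3 %| q * k + 1)%Z -> (n%:Z %| q * X + (n0%:Z - 1))%Z).
  move=> XE; split=> /dvd_n k3.
    rewrite (_ : _ - _ = (q * A - 1) + q * (X - A) - n0%:Z); last by ring.
    rewrite XE -addrA; apply: rpredD => //.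
    by rewrite (_ : _ - _ = (q * k - 1) * n0%:Z) //; ring.
  rewrite (_ : _ + _ = (q * A - 1) + (q * (X - A) + n0%:Z)); last by ring.
  rewrite XE; apply: rpredD => //.
  by rewrite (_ : _ + _ = (q * k + 1) * n0%:Z) //; ring.
have [B1 B2] := image _ _ iE; have [C1 C2] := image _ _ jE.
rewrite -pm3_B1.
have [[h1 h2]|[h1 h2]] := modz3_unit q3 i3 j3 ij3.
  rewrite pm3C23; apply: (unit_multiple_int (q := q)) => //; first by left.
    by right; apply: C2.
  by left; apply: B1.
apply: (unit_multiple_int (q := q)) => //; first by left.
  by right; apply: B2.
by left; apply: C1.
Qed.

(** When 9 divides n, the root for the prime 3 makes A, B, C congruent and nonzero modulo 3. A
    change of sign at another prime would leave some but not all of the differences divisible by 3,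
    against [thirds_logn]; so one choice of signs serves all primes. *)
Lemma thirdly_dvd3 n n0 (A B C : int) N : n = (3 * n0)%N -> (1 < n)%N -> (3 %| n0)%N ->
    jointly_coprime n A B C -> thirdly n A B C ->
    (N %| n)%N -> (n`_3 %| N)%N -> thirds N A B C ->
  unit_multiple (pm3 (A%:~R : 'Z_n) B%:~R C%:~R) (pm3 1 (n0%:R - 1) (n0%:R + 1)).
Proof.
move=> nE n_gt1 n0_3 gen inf N_n n_N thN; have n_gt0 := ltnW n_gt1.
have n0_gt0 : (0 < n0)%N by move: n_gt0; rewrite nE muln_gt0.
have N_gt0 := dvdn_gt0 n_gt0 N_n.
have n3 : (3 %| n)%N by rewrite nE dvdn_mulr.
have logN : logn 3 N = (logn 3 n0).+1.
  by rewrite (eq_logn_part _ n_gt0 N_n n_N) // nE lognM.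
have log_gt0 : (0 < logn 3 n0)%N by rewrite -(pfactor_dvdn 1).
have [logAB logAC [AB3 AC3 BC3]] := thirds_logn N_gt0 thN.
move: AB3 AC3; rewrite logN ltnS log_gt0 => AB3 AC3.
have A3 : ~~ (3 %| A)%Z.
  apply/negP => A3; apply: (gen 3%N isT n3); split=> //.
    by rewrite -(rpredBl _ A3).
  by rewrite -(rpredBl _ A3).
have parts p : prime p -> (p %| n)%N -> p != 3%N ->
    ((n`_p)%N%:Z %| A - B)%Z /\ ((n`_p)%N%:Z %| A - C)%Z.
  move=> p_pr p_n p3; have [M [B' [C' [M_n n_M B'E C'E thM]]]] := inf p p_pr p_n.
  have M_gt0 := dvdn_gt0 n_gt0 M_n.
  have [_ _ [E1 E2 E3]] := thirds_logn M_gt0 thM.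
  have [B'B C'C] : B' = B /\ C' = C.
    case: B'E C'E E1 E2 E3 => -> [] -> <- E2 E3; split => //; exfalso;
      by move: A3 AB3 AC3 E2 E3; clear; lia.
  by rewrite -B'B -C'C; apply: thirds_part thM.
have n0_dvd x : (0 < `|x|)%N -> (logn 3 `|x|).+1 = logn 3 N ->
    (forall p, prime p -> (p %| n)%N -> p != 3%N -> ((n`_p)%N%:Z %| x)%Z) ->
    (n0%:Z %| x)%Z.
  move=> x_gt0; rewrite logN => -[logx] x_p; apply: dvdz_part => // p p_pr p_n0.
  have [->|p3] := eqVneq p 3%N.
    by rewrite dvdzE absz_nat p_part pfactor_dvdn // logx.
  have p_n : (p %| n)%N by rewrite nE dvdn_mull.
  by apply: dvdz_dvdn (x_p p p_pr p_n p3); rewrite partn_dvd // nE dvdn_mull.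
have gt0 x : ~~ (N%:Z %| x)%Z -> (0 < `|x|)%N.
  by rewrite absz_gt0; apply: contra => /eqP ->; rewrite dvdz0.
have [_ _ nAB nAC nBC] := thN.
have n0AB : (n0%:Z %| A - B)%Z.
  by apply: n0_dvd; [exact: gt0 | | move=> p ? ? ?; have [] := parts p].
have n0AC : (n0%:Z %| A - C)%Z.
  by apply: n0_dvd; [exact: gt0 | | move=> p ? ? ?; have [] := parts p].
have ndvd x : ~~ (N%:Z %| x)%Z -> ~~ (n%:Z %| x)%Z by apply: contra; apply: dvdz_dvdn.
apply: unit_multiple_B1 => //; rewrite ?ndvd // 1?dvdz_subC ?ndvd //.
apply: coprimez_prime => // p p_pr p_n; have [->//|p3] := eqVneq p 3%N.
have [pAB pAC] := parts p p_pr p_n p3; have p_part := prime_dvd_part p_pr n_gt0 p_n.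
apply/negP => pA; apply: (gen p p_pr p_n); split=> //.
  by rewrite -(rpredBl _ pA); apply: dvdz_dvdn pAB.
by rewrite -(rpredBl _ pA); apply: dvdz_dvdn pAC.
Qed.

(** The divisors are d = gcd(A - 1, n0) and d' = gcd(A + 1, n0), exchanged by replacing A by -A, and
    c' is the residue of A. Being 1 modulo n0 and -1 modulo 3, C is n0 + 1 if delta = 1 and -(n0 -
    1) if delta = -1. If d = 1, then -A is 1 modulo n0 as well, which is family B1. *)
Lemma ndvd3_families n n0 (S : {set 'Z_n}) (A C : int) : n = (3 * n0)%N ->
    odd n0 -> ~~ (3 %| n0)%N -> (1 < n0)%N -> (3 %| A)%Z -> (3 %| C + 1)%Z ->
    (n0%:Z %| C - 1)%Z ->
    (forall p, prime p -> (p %| n0)%N ->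
       ((n0`_p)%N%:Z %| A - 1)%Z \/ ((n0`_p)%N%:Z %| A + 1)%Z) ->
    unit_multiple S (pm3 1%:~R A%:~R C%:~R) ->
  unit_multiple S (pm3 1 (n0%:R - 1) (n0%:R + 1)) \/ familyB2 n0 S.
Proof.
move=> nE odd_n0 n03 n0_gt1.
wlog le_d : A / (gcdn `|(A - 1)%R| n0 <= gcdn `|(A + 1)%R| n0)%N.
  move=> main A3 C3 n0C parts mult.
  have [le_d|/ltnW le_d] := leqP (gcdn `|(A - 1)%R| n0) (gcdn `|(A + 1)%R| n0).
    exact: main le_d A3 C3 n0C parts mult.
  have E1 : - A - 1 = - (A + 1) by ring.
  have E2 : - A + 1 = - (A - 1) by ring.
  apply: (main (- A)); rewrite ?E1 ?E2 ?abszN ?dvdz_oppr //.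
    by move=> p p_pr p_n0; rewrite ?E1 ?E2 !dvdz_oppr; case: (parts p p_pr p_n0); auto.
  by rewrite mulrNz pm3C12 pm3N1 pm3C12.
move=> A3 C3 n0C parts mult; have n0_gt0 := ltnW n0_gt1.
have n_gt1 : (1 < n)%N by rewrite nE (leq_trans n0_gt1) // leq_pmull.
set d := gcdn _ _ in le_d; set d' := gcdn _ _ in le_d.
have d_dvd : (d%:Z %| A - 1)%Z by exact: gcdn_dvdz.
have d'_dvd : (d'%:Z %| A + 1)%Z by exact: gcdn_dvdz.
have d_n0 : (d %| n0)%N by exact: dvdn_gcdr.
have d'_n0 : (d' %| n0)%N by exact: dvdn_gcdr.
have co : coprime d d'.
  apply: coprime_gcdn_prime => // p p_pr p_n0 p1 p2.
  have odd_p := dvdn_odd p_n0 odd_n0.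
  have : (p%:Z %| (A + 1) - (A - 1))%Z by rewrite rpredB.
  rewrite (_ : _ - _ = 2); last by ring.
  by rewrite dvdzE absz_nat dvdn_prime2 // => /eqP p2'; rewrite p2' in odd_p.
have co_d3 : coprime d 3.
  by rewrite coprime_sym prime_coprime //; apply: contra n03 => d3; apply: dvdn_trans d_n0.
have co_d'3 : coprime d' 3.
  by rewrite coprime_sym prime_coprime //; apply: contra n03 => d3; apply: dvdn_trans d'_n0.
have n0E : n0 = (d * d')%N.
  apply/eqP; rewrite eqn_dvd Gauss_dvd // d_n0 d'_n0 /= andbT.
  apply/(dvdn_partP _ n0_gt0) => p; rewrite mem_primes => /and3P[p_pr _ p_n0].
  case: (parts p p_pr p_n0) => /dvdz_gcdn/(_ (dvdn_part p n0)) dvd.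
    by rewrite dvdn_mulr.
  by rewrite dvdn_mull.
have dvd_n (x : int) :
    (n%:Z %| x)%Z = [&& (3 %| x)%Z, (d%:Z %| x)%Z & (d'%:Z %| x)%Z].
  by rewrite nE n0E dvdz_3mul2.
have dvd_n0 (x : int) : (n%:Z %| x)%Z = (3 %| x)%Z && (n0%:Z %| x)%Z.
  by rewrite nE PoszM Gauss_dvdz // coprimezE /= prime_coprime.
have [d1|d_neq1] := eqVneq d 1%N.
  left; apply: unit_multiple_trans mult _.
  rewrite pm3C12 -pm3N1 pm3C12 -mulrNz.
  have n0A : (n0%:Z %| A + 1)%Z by rewrite n0E d1 mul1n.
  apply: unit_multiple_B1 => //; rewrite ?dvd_n0 ?negb_and.
  - by rewrite coprimezE coprimen1.
  - by rewrite -dvdz_oppr opprB opprK addrC.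
  - by apply/orP; left; move: A3; clear; lia.
  - by apply/orP; left; move: C3; clear; lia.
  - by apply/orP; left; move: A3 C3; clear; lia.
right.
have d_gt1 : (1 < d)%N by rewrite ltn_neqAle eq_sym d_neq1 gcdn_gt0 n0_gt0 orbT.
have d_lt : (d < d')%N.
  rewrite ltn_neqAle le_d andbT; apply: contra d_neq1 => /eqP dd'.
  by move: co; rewrite -dd' /coprime gcdnn.
have [c' c'_n c'A] := nat_residue A (ltnW n_gt1).
move: (c'A); rewrite dvd_n => /and3P[c'3 c'd c'd'].
have {}c'3 : (3 %| c'%:Z)%Z by rewrite -(subrK A c'%:Z) rpredD.
have {}c'd : (d%:Z %| c'%:Z - 1)%Z by apply: dvdz_sub_trans c'd d_dvd.
have {}c'd' : (d'%:Z %| c'%:Z - (- 1))%Z.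
  by apply: dvdz_sub_trans c'd' _; rewrite opprK.
have [delta [deltaE n0delta]] : exists delta : int,
    (delta = - 1 \/ delta = 1) /\ (n0%:Z = delta %[mod 3])%Z.
  have [h|h] : (n0%:Z = - 1 %[mod 3])%Z \/ (n0%:Z = 1 %[mod 3])%Z.
    by move: n03; clear; lia.
  - by exists (- 1); auto.
  - by exists 1; auto.
have c'_bd x : (x < n)%N -> (d%:Z %| x%:Z - 1)%Z -> (1 <= x <= n - 1)%N.
  move=> x_n xd; rewrite leq_subRL ?(ltnW n_gt1) // add1n x_n andbT lt0n.
  apply: contra d_neq1 => /eqP x0; move: xd; rewrite x0 sub0r dvdz_oppr.
  by rewrite dvdzE !absz_nat dvdn1.
exists d, d', delta, c'; split=> //.
- by rewrite d_gt1 d_lt.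
- split.
    by split; [exact: c'_bd | | |]; apply/eqP; rewrite eqz_mod_dvd ?subr0.
  move=> y [/andP[y_ge1 y_n] /eqP y3 /eqP yd /eqP yd'].
  move: y3 yd yd'; rewrite !eqz_mod_dvd subr0 => y3 yd yd'.
  have {}y_n : (y < n)%N by move: y_n; rewrite leq_subRL ?(ltnW n_gt1).
  apply: dvdz_nat_eq c'_n y_n _; rewrite dvd_n; apply/and3P; split.
  - by rewrite rpredB.
  - by apply: dvdz_sub_trans c'd _; rewrite dvdz_subC.
  - by apply: dvdz_sub_trans c'd' _; rewrite dvdz_subC.
apply: unit_multiple_trans mult _; rewrite pm3C23.
have -> : pm3 1 (n0%:R + delta%:~R) c'%:R =
    pm3 ((1 : int)%:~R : 'Z_n) (n0%:Z + delta)%:~R c'%:Z%:~R.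
  by rewrite intrD -!pmulrn.
apply: (@unit_multiple_int n 1); rewrite ?mul1r ?subrr ?dvdz0 //; try by left.
- by rewrite coprimezE coprimen1.
- case: deltaE n0delta => -> n0delta; [right | left]; rewrite dvd_n0; apply/andP; split.
  + by move: C3 n0delta; clear; lia.
  + rewrite (_ : C + _ = (C - 1) + n0%:Z); last by ring.
    by rewrite rpredD.
  + by move: C3 n0delta; clear; lia.
  + rewrite (_ : C - _ = (C - 1) - n0%:Z); last by ring.
    by rewrite rpredB.
by left; rewrite dvdz_subC.
Qed.

(** Here 9 does not divide n, so for no prime is a difference divisible by 3. As B + C is divisible
    by 3, B and C must carry the same sign at every prime; hence n0 divides B - C, and only the sign
    relative to A varies. *)
Lemma thirdly_ndvd3 n n0 (A B C : int) : n = (3 * n0)%N -> odd n0 -> ~~ (3 %| n0)%N ->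
    (1 < n0)%N -> jointly_coprime n A B C -> thirdly n A B C ->
    (3 %| A)%Z -> ~~ (3 %| B)%Z -> ~~ (3 %| C)%Z -> ~~ (3 %| B - C)%Z ->
  unit_multiple (pm3 (A%:~R : 'Z_n) B%:~R C%:~R) (pm3 1 (n0%:R - 1) (n0%:R + 1)) \/
  familyB2 n0 (pm3 (A%:~R : 'Z_n) B%:~R C%:~R).
Proof.
move=> nE odd_n0 n03 n0_gt1 gen inf A3 B3 C3 BC3; have n0_gt0 := ltnW n0_gt1.
have n_gt1 : (1 < n)%N by rewrite nE (leq_trans n0_gt1) // leq_pmull.
have n_gt0 := ltnW n_gt1.
have BC3' : (3 %| B + C)%Z by move: B3 C3 BC3; clear; lia.
have parts p : prime p -> (p %| n0)%N -> ((n0`_p)%N%:Z %| B - C)%Z /\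
    (((n0`_p)%N%:Z %| A - B)%Z \/ ((n0`_p)%N%:Z %| A + B)%Z).
  move=> p_pr p_n0; have p_n : (p %| n)%N by rewrite nE dvdn_mull.
  have p3 : p != 3%N by apply: contra n03 => /eqP <-.
  have [M [B' [C' [M_n n_M B'E C'E thM]]]] := inf p p_pr p_n.
  have M_gt0 := dvdn_gt0 n_gt0 M_n.
  have [_ _ [_ _ E3]] := thirds_logn M_gt0 thM.
  have {}E3 : ~~ (3 %| B' - C')%Z.
    rewrite E3 -leqNgt (leq_trans (dvdn_leq_log 3 n_gt0 M_n)) // nE lognM //.
    by rewrite [logn 3 n0]lognE (negbTE n03) !andbF.
  have [pAB pAC] := thirds_part p_pr p3 n_gt0 n_M thM.
  have p_part : ((n0`_p)%N %| (n`_p)%N)%N by apply: partn_dvd; rewrite // nE dvdn_mull.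
  have {}pAB := dvdz_dvdn p_part pAB; have {}pAC := dvdz_dvdn p_part pAC.
  case: B'E C'E pAB pAC E3 => -> [] ->; rewrite ?opprK => pAB pAC E3.
  - split; last by left.
    by rewrite (_ : B - C = (A - C) - (A - B)); [rewrite rpredB | ring].
  - by rewrite BC3' in E3.
  - by rewrite -opprD dvdz_oppr BC3' in E3.
  - split; last by right.
    by rewrite (_ : B - C = (A + B) - (A + C)); [rewrite rpredB | ring].
have n0BC : (n0%:Z %| B - C)%Z.
  by apply: dvdz_part => // p p_pr p_n0; have [] := parts p p_pr p_n0.
have coB : coprimez n%:Z B.
  apply: coprimez_prime => // p p_pr p_n; apply/negP => pB.
  have p3 : p != 3%N by apply: contra B3 => /eqP p3; move: pB; rewrite p3.
  have p_n0 : (p %| n0)%N.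
    by move: p_n; rewrite nE Euclid_dvdM // dvdn_prime2 // (negbTE p3).
  have [pBC pAB] := parts p p_pr p_n0.
  have p_part := dvdz_dvdn (prime_dvd_part p_pr n0_gt0 p_n0).
  apply: (gen p p_pr p_n); split=> //.
    by case: pAB => /p_part; [rewrite (rpredBr _ pB) | rewrite (rpredDr _ pB)].
  by rewrite -(rpredBl _ pB); apply: p_part.
have [q co_q qB] := inverse_modz coB.
have qB3 : (3 %| q * B - 1)%Z by apply: dvdz_dvdn qB; rewrite nE dvdn_mulr.
have qBn0 : (n0%:Z %| q * B - 1)%Z by apply: dvdz_dvdn qB; rewrite nE dvdn_mull.
apply: (@ndvd3_families n n0 _ (q * A) (q * C)) => //.
- by rewrite dvdz_mull.
- rewrite (_ : _ + 1 = q * (B + C) - (q * B - 1)); last by ring.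
  by rewrite rpredB // dvdz_mull.
- rewrite (_ : _ - 1 = (q * B - 1) - q * (B - C)); last by ring.
  by rewrite rpredB // dvdz_mull.
- move=> p p_pr p_n0; have [_ pAB] := parts p p_pr p_n0.
  have pB := dvdz_dvdn (dvdn_part p n0) qBn0.
  case: pAB => pAB; [left | right].
    rewrite (_ : _ - 1 = q * (A - B) + (q * B - 1)); last by ring.
    by rewrite rpredD // dvdz_mull.
  rewrite (_ : _ + 1 = q * (A + B) - (q * B - 1)); last by ring.
  by rewrite rpredB // dvdz_mull.
rewrite pm3C12; apply: (unit_multiple_int (q := q)) => //; first by left.
  by left; rewrite subrr dvdz0.
by left; rewrite subrr dvdz0.
Qed.

Lemma familiesB_necessary n (S : {set 'Z_n}) (a b c : 'Z_n) : (7 <= n)%N ->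
    S = pm3 a b c -> #|S| = 6%N -> <<S>>%g = [set: 'Z_n] -> ~~ (4 %| n)%N ->
    distance_magic (circ S) ->
  odd n /\ exists n0 : nat, [/\ n = (3 * n0)%N, (3 <= n0)%N &
    unit_multiple S (pm3 1 (n0%:R - 1) (n0%:R + 1)) \/ familyB2 n0 S].
Proof.
move=> n_ge7 SE card6 gen n4 dm; have n_gt1 : (1 < n)%N by apply: leq_trans n_ge7.
have n_gt0 := ltnW n_gt1.
have [A [B [C SABC]]] := int_triple_exists SE.
have odd_n : odd n.
  move: (card6) (dm); rewrite SABC => card6' dm'.
  by have [|n4'] := distance_magic_pm3_mod4 n_gt1 card6' dm'; last rewrite n4' in n4.
split=> //.
have cop X Y Z (SX : int_triple S X Y Z) := generate_jointly_coprime n_gt1 gen SX.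
have inf X Y Z : int_triple S X Y Z -> thirdly n X Y Z.
  move=> SX p p_pr p_n; move: card6 dm; rewrite SX => card6' dm'.
  exact: distance_magic_thirds n_gt1 odd_n card6' dm' p_pr p_n.
have n3 : (3 %| n)%N.
  have [N [B' [C' [N_n _ _ _ th]]]] := inf _ _ _ SABC _ (pdiv_prime n_gt1) (pdiv_dvd n).
  have N_gt0 := dvdn_gt0 n_gt0 N_n; have [logN _ _] := thirds_logn N_gt0 th.
  by apply: dvdn_trans N_n; rewrite (@pfactor_dvdn 3 1) // -logN.
have /dvdnP[n0 n0E] := n3; have {n0E} nE : n = (3 * n0)%N by rewrite mulnC.
have n0_ge3 : (3 <= n0)%N by move: n_ge7; rewrite nE; case: n0 {nE} => [|[|[|]]].
have n0_gt1 : (1 < n0)%N by apply: leq_trans n0_ge3.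
have odd_n0 : odd n0 by move: odd_n; rewrite nE oddM.
exists n0; split=> //.
(* The root for the prime 3 fixes the signs of the triple. If 3 does not divide n0, its members are
   distinct modulo 3, and the one divisible by 3 is moved to the front. *)
have [N [B' [C' [N_n n_N B'E C'E th]]]] := inf _ _ _ SABC 3%N isT n3.
have SABC' : int_triple S A B' C'.
  have SAB' : int_triple S A B' C.
    by case: B'E => -> //; apply/int_tripleC12/int_tripleN1/int_tripleC12.
  by case: C'E => -> //; apply/int_tripleC23/int_tripleC12/int_tripleN1/int_tripleC12/int_tripleC23.
have [n03|n03] := boolP (3 %| n0)%N.
  left; move: (cop _ _ _ SABC') (inf _ _ _ SABC'); rewrite SABC' => gen' inf'.
  exact: thirdly_dvd3 gen' inf' N_n n_N th.
have N_gt0 := dvdn_gt0 n_gt0 N_n.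
have logn1 : logn 3 n = 1%N.
  by rewrite nE lognM ?(ltnW n0_gt1) // [logn 3 n0]lognE (negbTE n03) !andbF.
have [_ _ []] := thirds_logn N_gt0 th.
rewrite (eq_logn_part _ n_gt0 N_n n_N) // logn1 ltnn => AB3 AC3 BC3.
have main X Y Z : int_triple S X Y Z -> (3 %| X)%Z -> ~~ (3 %| X - Y)%Z ->
    ~~ (3 %| X - Z)%Z -> ~~ (3 %| Y - Z)%Z ->
    unit_multiple S (pm3 1 (n0%:R - 1) (n0%:R + 1)) \/ familyB2 n0 S.
  move=> SX X3; rewrite !(rpredBl _ X3) => Y3 Z3 YZ3.
  move: (cop _ _ _ SX) (inf _ _ _ SX); rewrite SX => genX infX.
  exact: thirdly_ndvd3 genX infX X3 Y3 Z3 YZ3.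
have [A3|A3] := boolP (3 %| A)%Z; first by apply: main SABC' A3 _ _ _; rewrite ?AB3 ?AC3 ?BC3.
have [B3|B3] := boolP (3 %| B')%Z.
  by apply: main (int_tripleC12 SABC') B3 _ _ _;
    [rewrite dvdz_subC AB3 | rewrite BC3 | rewrite AC3].
apply: main (int_tripleC12 (int_tripleC23 SABC')) _ _ _ _.
- by move: A3 B3 AB3 AC3 BC3; clear; lia.
- by rewrite dvdz_subC AC3.
- by rewrite dvdz_subC BC3.
- by rewrite AB3.
Qed.

Lemma familiesB_sufficient n n0 (S : {set 'Z_n}) : odd n -> n = (3 * n0)%N -> (3 <= n0)%N ->
    #|S| = 6%N ->
    unit_multiple S (pm3 1 (n0%:R - 1) (n0%:R + 1)) \/ familyB2 n0 S ->
  distance_magic (circ S).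
Proof.
move=> odd_n nE n0_ge3 card6; have odd_n0 : odd n0 by move: odd_n; rewrite nE oddM.
have n_gt1 : (1 < n)%N by rewrite nE (leq_trans (ltnW n0_ge3)) // leq_pmull.
have reduce T : unit_multiple S T -> (#|T| = 6%N -> distance_magic (circ T)) ->
    distance_magic (circ S).
  move=> mult dmT; apply: distance_magic_unit_multiple (mult) (dmT _).
  by rewrite (card_unit_multiple mult).
case=> [mult|[d [d' [delta [c' [H1 [deltaE n0delta] [H2 _] mult]]]]]]; apply: reduce mult _.
  by rewrite -pm3_B1; apply: distance_magic_coset3 nE odd_n0 n_gt1 _ _ _.
move: H1 H2 => [n0E co _ co3 co3'] [_ c3 cd cd'].
move: (modz_eq_dvdz c3) (modz_eq_dvdz cd) (modz_eq_dvdz cd').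
rewrite subr0 opprK => {}c3 {}cd {}cd'.
have [odd_d odd_d'] : odd d /\ odd d'.
  by apply/andP; rewrite -oddM -n0E.
(* The sign delta makes the second element 1 modulo n0 and -1 modulo 3, so that it agrees with 1
   modulo d and d', and 1, it and c' are distinct modulo 3. *)
have -> : pm3 1 (n0%:R + delta%:~R) c'%:R =
    pm3 ((1 : int)%:~R : 'Z_n) (delta * (n0%:Z + delta))%:~R c'%:Z%:~R.
  apply/esym/pm3_eqN; [by left | | by left; rewrite pmulrn].
  case: deltaE => ->; [right | left]; last by rewrite mul1r intrD.
  by rewrite mulN1r mulrNz intrD.
have dvd_d e : (e %| n0)%N -> (e%:Z %| 1 - delta * (n0%:Z + delta))%Z.
  move=> e_n0; rewrite (_ : 1 - _ = - delta * n0%:Z); last by case: deltaE => ->; ring.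
  by rewrite dvdz_mull.
have nE' : n = (3 * (d * d'))%N by rewrite -n0E.
apply: (distance_magic_kotzig2 nE' odd_d odd_d' n_gt1 co co3 co3') => //.
- by case: deltaE n0delta => ->; clear; lia.
- by move: c3; clear; lia.
- by case: deltaE n0delta => ->; move: c3; clear; lia.
- by apply: dvd_d; rewrite n0E dvdn_mulr.
- by rewrite dvdz_subC.
- by apply: dvd_d; rewrite n0E dvdn_mull.
- by rewrite addrC.
Qed.

Theorem theorem6p3 (n : nat) (a b c : 'Z_n) (S : {set 'Z_n})
    (n_ge7 : (7 <= n)%N) (S_def : S = pm3 a b c) (cardS : #|S| = 6%N)
    (genS : <<S>>%g = [set: 'Z_n]) :
  (~~ (3 %| n)%N ->
   (distance_magic (circ S) <->
    exists n0 : nat, [/\ n = (4 * n0)%N, (2 <= n0)%N &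
     [\/ unit_multiple S (pm3 1 n0%:R (2 * n0%:R - 1)),
         unit_multiple S (pm3 2 n0%:R (2 * n0%:R - 2)),
         exists d d' c' : nat,
           [/\ [/\ n0 = (d * d')%N, odd d, odd d', coprime d d'
                 & (1 < d < d')%N /\ (d' < n0)%N],
               unique (fun x : nat =>
                 [/\ (1 < x < n)%N,
                     (x%:Z = 0 %[mod 4])%Z,
                     (x%:Z = 2 %[mod d%:Z])%Z
                   & (x%:Z = - 2 %[mod d'%:Z])%Z]) c'
             & unit_multiple S (pm3 2 n0%:R c'%:R)]
       | exists d d' d'' b' c' : nat,
           [/\ [/\ n0 = (d * d' * d'')%N,
                   [/\ odd d, odd d' & odd d''],
                   [/\ coprime d d', coprime d d'' & coprime d' d'']
                 & (1 <= d < d')%N /\ (d' < d'' < n0)%N],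
               (let P := fun x : nat =>
                  [/\ (1 < x < n)%N,
                      (x%:Z = 2 - d%:Z %[mod 4])%Z,
                      (x%:Z = 0 %[mod d'%:Z])%Z,
                      (x%:Z = - d%:Z %[mod d''%:Z])%Z
                    & gcdn x d = 1%N] in
                P b' /\ forall x : nat, P x -> (b' <= x)%N),
               unique (fun x : nat =>
                 [/\ (1 < x < n)%N,
                     (x%:Z = 2 - d%:Z %[mod 4])%Z,
                     (x%:Z = - b'%:Z %[mod d%:Z])%Z,
                     (x%:Z = - d%:Z %[mod d'%:Z])%Z
                   & (x%:Z = 0 %[mod d''%:Z])%Z]) c'
             & unit_multiple S (pm3 d%:R b'%:R c'%:R)]]]))
  /\
  (~~ (4 %| n)%N ->
   (distance_magic (circ S) <->
    odd n /\
    exists n0 : nat, [/\ n = (3 * n0)%N, (3 <= n0)%N &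
      unit_multiple S (pm3 1 (n0%:R - 1) (n0%:R + 1)) \/
      exists (d d' : nat) (delta : int) (c' : nat),
        [/\ [/\ n0 = (d * d')%N, coprime d d', (1 < d < d')%N,
                coprime d 3 & coprime d' 3],
            (delta = - 1 \/ delta = 1) /\ (n0%:Z = delta %[mod 3])%Z,
            unique (fun x : nat =>
              [/\ (1 <= x <= n - 1)%N,
                  (x%:Z = 0 %[mod 3])%Z,
                  (x%:Z = 1 %[mod d%:Z])%Z
                & (x%:Z = - 1 %[mod d'%:Z])%Z]) c'
          & unit_multiple S (pm3 1 (n0%:R + delta%:~R) c'%:R)]])).
Proof.
split=> [n3|n4]; split.
- exact: familiesA_necessary n_ge7 S_def cardS genS n3.
- by case=> n0 [nE n0_ge2 fam]; apply: familiesA_sufficient nE n0_ge2 cardS fam.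
- exact: familiesB_necessary n_ge7 S_def cardS genS n4.
- case=> odd_n [n0 [nE n0_ge3 fam]].
  exact: familiesB_sufficient odd_n nE n0_ge3 cardS fam.
Qed.
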